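(* Let $\Pi$ be a (finite, nonempty) set of patterns, the longest of which has length $k$. One can count the permutations in $S_n$ by number of $\Pi$-hits (that is, compute for every integer $m\ge 0$ the number of $\tau\in S_n$ having exactly $m$ $\Pi$-hits) in $O(n!\,k)$ time using $O(n^{k+1}k)$ space.
   Context: A permutation in $S_n$ is a word containing each of $1,\dots,n$ exactly once. For $\pi\in S_m$ and $\tau\in S_n$, a $\pi$-hit in $\tau$ is an $m$-letter subsequence of $\tau$ order-isomorphic to $\pi$; a $\Pi$-hit is a $\pi$-hit for some $\pi\in\Pi$. Model of computation: a word RAM in which each permutation of length at most $n$ (letters stored in fixed-width bit blocks) and each count fits in a constant number of machine words, standard integer and bitwise operations and shifts take constant time, hash tables keyed by such words support insertion, deletion and lookup in constant time; space is measured in machine words. *)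

(* Defs.v *)
From Stdlib Require Export NArith.
From mathcomp Require Export all_boot.

Set Implicit Arguments.
Unset Strict Implicit.
Unset Printing Implicit Defensive.

(** * Permutations, patterns and hits *)

Definition is_permutation (n : nat) (tau : seq nat) : bool :=
  perm_eq tau (iota 1 n).

Definition order_isomorphic (s t : seq nat) : bool :=
  (size s == size t) &&
  [forall i : 'I_(size s), forall j : 'I_(size s),
     (nth 0 s i < nth 0 s j) == (nth 0 t i < nth 0 t j)].

(* A subsequence of [tau] is given by the bit mask selecting its positions. *)
Definition is_hit (Pi : seq (seq nat)) (tau : seq nat) (b : bitseq) : bool :=
  has (order_isomorphic (mask b tau)) Pi.

Definition num_hits (Pi : seq (seq nat)) (tau : seq nat) : nat :=
  #|[set b : (size tau).-tuple bool | is_hit Pi tau b]|.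

Definition num_perms_with_hits (Pi : seq (seq nat)) (n m : nat) : nat :=
  count (fun tau => num_hits Pi tau == m) (permutations (iota 1 n)).

(** * Word RAM with hash tables

    Words of width [w] are the elements of [N] below 2^w; arithmetic is modulo
    2^w.  Registers and hash tables are named statically by the program, memory
    cells are addressed by words.  Every instruction takes one time unit. *)

Inductive binop : Type :=
  | Add | Sub | Mul | Div | Mod | And | Or | Xor | Shl | Shr.

Inductive instr : Type :=
  | Const  (rd : nat) (v : N)
  | Op     (op : binop) (rd r1 r2 : nat)
  | Read   (rd ra : nat)
  | Write  (ra rv : nat)
  | Insert (tab : nat) (rk rv : nat)
  | Delete (tab : nat) (rk : nat)
  (* [rf] receives 1 if the key is present and 0 otherwise *)
  | Lookup (tab : nat) (rd rf rk : nat)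
  | Jump   (target : nat)
  | JumpLt (r1 r2 : nat) (target : nat)
  | JumpEq (r1 r2 : nat) (target : nat)
  | Halt.

Definition program := seq instr.

Definition table := seq (N * N).

Definition tdelete (t : table) (key : N) : table :=
  [seq e <- t | ~~ N.eqb e.1 key].

Definition tinsert (t : table) (key v : N) : table := (key, v) :: tdelete t key.

Definition tlookup (t : table) (key : N) : option N :=
  omap snd (ohead [seq e <- t | N.eqb e.1 key]).

(* Registers, memory cells and tables that were never written are 0, 0 and
   empty; writing at index [i] extends the sequence to size at least [i.+1]. *)
Record state : Type := State {
  pc   : nat;
  regs : seq N;
  mem  : seq N;
  tabs : seq table }.

Definition reg (st : state) (r : nat) : N := nth N0 (regs st) r.
Definition cell (st : state) (a : nat) : N := nth N0 (mem st) a.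
Definition tab (st : state) (h : nat) : table := nth [::] (tabs st) h.

Definition wrap (w : nat) (x : N) : N := N.modulo x (N.pow 2 (N.of_nat w)).

Definition eval_binop (w : nat) (op : binop) (x y : N) : N :=
  wrap w match op with
  | Add => N.add x y
  | Sub => N.sub (N.add x (N.pow 2 (N.of_nat w))) y
  | Mul => N.mul x y
  | Div => N.div x y
  | Mod => N.modulo x y
  | And => N.land x y
  | Or  => N.lor x y
  | Xor => N.lxor x y
  | Shl => N.shiftl x y
  | Shr => N.shiftr x y
  end.

Definition set_reg (rs : seq N) (r : nat) (v : N) : seq N := set_nth N0 rs r v.

Definition current_instr (p : program) (st : state) : instr :=
  nth Halt p (pc st).

Definition step (p : program) (w : nat) (st : state) : state :=
  let: State i rs ms ts := st in
  match current_instr p st with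
  | Const rd v => State i.+1 (set_reg rs rd (wrap w v)) ms ts
  | Op op rd r1 r2 =>
      State i.+1 (set_reg rs rd (eval_binop w op (reg st r1) (reg st r2))) ms ts
  | Read rd ra =>
      State i.+1 (set_reg rs rd (cell st (N.to_nat (reg st ra)))) ms ts
  | Write ra rv =>
      State i.+1 rs (set_nth N0 ms (N.to_nat (reg st ra)) (reg st rv)) ts
  | Insert h rk rv =>
      State i.+1 rs ms
        (set_nth [::] ts h (tinsert (tab st h) (reg st rk) (reg st rv)))
  | Delete h rk =>
      State i.+1 rs ms (set_nth [::] ts h (tdelete (tab st h) (reg st rk)))
  | Lookup h rd rf rk =>
      let: (v, f) := if tlookup (tab st h) (reg st rk) is Some v
                     then (v, 1%num) else (N0, N0) in
      State i.+1 (set_reg (set_reg rs rd v) rf f) ms ts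
  | Jump l => State l rs ms ts
  | JumpLt r1 r2 l =>
      State (if N.ltb (reg st r1) (reg st r2) then l else i.+1) rs ms ts
  | JumpEq r1 r2 l =>
      State (if N.eqb (reg st r1) (reg st r2) then l else i.+1) rs ms ts
  | Halt => st
  end.

Definition run (p : program) (w : nat) (t : nat) (st : state) : state :=
  iter t (step p w) st.

Definition halted (p : program) (st : state) : bool :=
  if current_instr p st is Halt then true else false.

(* Since never-written cells below the highest written address are included in
   [size (mem st)], sparse use of the memory is charged in full. *)
Definition space (st : state) : nat :=
  size (regs st) + size (mem st) + \sum_(h <- tabs st) (size h).+1.

(** * Encoding of the input and the output *)

(* number of binary digits of [n], i.e. enough for every letter 1, ..., n *)
Definition block_width (n : nat) : nat := (trunc_log 2 n).+1.

(* The first letter occupies the low-order block.  As letters are nonzero, the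
   code determines the permutation, including its length. *)
Definition encode (n : nat) (tau : seq nat) : N :=
  foldr (fun a acc =>
           N.add (N.of_nat a) (N.shiftl acc (N.of_nat (block_width n))))
        N0 tau.

(* The input consists of n, the number of listed patterns, and the codes of the
   patterns.  Only permutations of length at most n are representable, so the
   patterns longer than n (which have no hits in a permutation of length n) are
   not listed; nothing is omitted when all patterns have length at most n. *)
Definition input (Pi : seq (seq nat)) (n : nat) : state :=
  let Pin := [seq p <- Pi | size p <= n] in
  State 0 [::]
    [:: N.of_nat n, N.of_nat (size Pin) & [seq encode n p | p <- Pin]] [::].

(* The output is an array: register 0 holds its address, register 1 its length;
   entries beyond its length are understood to be 0. *)
Definition output (st : state) (m : nat) : N :=
  if m < N.to_nat (reg st 1) then cell st (N.to_nat (reg st 0) + m) else N0.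

(* Main.v *)
Require Import Defs.
From mathcomp Require Import zify.

(** For words [u] and [y] without common letters let [h(u, y)] be the number of
    subsequences [v] of [u] for which [y v] is order-isomorphic to a pattern.  Then
    [h(a u, y) = h(u, y) + h(u, y a)], the value [h(empty, y)] only says whether
    [y] itself is a copy of a pattern, and [h(tau, empty)] is the number of hits
    in [tau].

    The program searches depth-first through the words [u] obtained by prepending
    unused letters of 1, ..., n.  On reaching a word [u] of length [j], an inner
    depth-first search runs through the words [y] of at most [k] unused letters and
    stores [h(u, y)] in a hash table under the key [(j, y)], reading the two values
    of the recurrence at level [j - 1].  Values of an abandoned branch are simply
    overwritten, so that the number of keys is at most n + 1 times the number of
    words of length at most [k].  For each length of [y] the pairs [(u, y)] are
    visited at most sum_m n! / (n - m)! < 3 n! times, which gives the time bound.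

    Words are numbers in base 2^bw, so one letter is pushed, popped, taken out of or
    put back into the list of unused letters by constantly many divisions and
    multiplications.  Order-isomorphism is equality of Lehmer codes, and the search
    gets these for free: a digit is a letter minus its index in the increasing list
    of unused letters. *)

Set Implicit Arguments.
Unset Strict Implicit.
Unset Printing Implicit Defensive.

(** * A machine on natural numbers *)

(** [eqn] instead of [==] lets a short list of constants suffice to decide by [lazy] whether two
    literal register numbers agree. *)
Definition upd (T : Type) (f : nat -> T) (k : nat) (v : T) : nat -> T :=
  fun x => if eqn x k then v else f x.

Lemma updE (T : Type) (f : nat -> T) k v x :
  upd f k v x = if x == k then v else f x.
Proof. by []. Qed.

Record mstate : Type := MState {
  mreg : nat -> nat;
  mmem : nat -> nat;
  mtab : nat -> nat -> option nat }.

(** Agrees with the word operation only under [binop_safe] below, which excludes wrap-around,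
    negative differences and the operations sent to 0 here. *)
Definition nat_binop (op : binop) (x y : nat) : nat :=
  match op with
  | Add => x + y
  | Sub => x - y
  | Mul => x * y
  | Div => x %/ y
  | Mod => x %% y
  | Shl => x * 2 ^ y
  | _ => 0
  end.

Definition exec1 (i : instr) (s : mstate) : mstate :=
  let: MState R M T := s in
  match i with
  | Const rd v => MState (upd R rd (N.to_nat v)) M T
  | Op op rd r1 r2 => MState (upd R rd (nat_binop op (R r1) (R r2))) M T
  | Read rd ra => MState (upd R rd (M (R ra))) M T
  | Write ra rv => MState R (upd M (R ra) (R rv)) T
  | Insert h rk rv => MState R M (upd T h (upd (T h) (R rk) (Some (R rv))))
  | Lookup h rd rf rk =>
      MState (upd (upd R rd (odflt 0 (T h (R rk)))) rf (isSome (T h (R rk)))) M T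
  | _ => s
  end.

Definition next_pc (i : instr) (pc : nat) (s : mstate) : nat :=
  match i with
  | Jump l => l
  | JumpLt r1 r2 l => if mreg s r1 < mreg s r2 then l else pc.+1
  | JumpEq r1 r2 l => if eqn (mreg s r1) (mreg s r2) then l else pc.+1
  | Halt => pc
  | _ => pc.+1
  end.

Definition straight (i : instr) : bool :=
  match i with
  | Jump _ | JumpLt _ _ _ | JumpEq _ _ _ | Halt => false
  | _ => true
  end.

Lemma pow2_of_nat n : N.pow 2 (N.of_nat n) = N.of_nat (2 ^ n).
Proof. by elim: n => // n IH; rewrite expnS Nat2N.inj_succ N.pow_succ_r' IH; lia. Qed.

Lemma div_of_nat x y : N.div (N.of_nat x) (N.of_nat y) = N.of_nat (x %/ y).
Proof.
case: y => [|y]; first by rewrite divn0; case: x.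
symmetry; apply: (N.div_unique _ _ _ (N.of_nat (x %% y.+1))).
  by have := ltn_pmod x (ltn0Sn y); lia.
by have := divn_eq x y.+1; lia.
Qed.

Lemma mod_of_nat x y : N.modulo (N.of_nat x) (N.of_nat y) = N.of_nat (x %% y).
Proof.
case: y => [|y]; first by rewrite modn0; case: x.
symmetry; apply: (N.mod_unique _ _ (N.of_nat (x %/ y.+1))).
  by have := ltn_pmod x (ltn0Sn y); lia.
by have := divn_eq x y.+1; lia.
Qed.

Lemma tdelete_fst t k : map fst (tdelete t k) = [seq x <- map fst t | x != k].
Proof.
elim: t => //= e t IH; rewrite /tdelete /= in IH *.
by have -> : N.eqb e.1 k = (e.1 == k) by []; case: eqP => /= _; rewrite IH.
Qed.

Lemma tlookup_tinsert t k v k' :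
  tlookup (tinsert t k v) k' = if k' == k then Some v else tlookup t k'.
Proof.
rewrite /tlookup /tinsert /=.
have -> : N.eqb k k' = (k' == k) by rewrite eq_sym.
case: eqP => //= /eqP ne; congr (omap _ (ohead _)).
rewrite -filter_predI; apply: eq_filter => e /=.
have -> : N.eqb e.1 k' = (e.1 == k') by [].
have -> : N.eqb e.1 k = (e.1 == k) by [].
by case: eqP => //= ->.
Qed.

Lemma tinsert_keys t k v (S : seq N) :
  uniq (map fst t) -> {subset map fst t <= S} -> k \in S ->
  uniq (map fst (tinsert t k v)) /\ {subset map fst (tinsert t k v) <= S}.
Proof.
move=> U Sub kS; rewrite /tinsert /= tdelete_fst; split.
  by rewrite mem_filter eqxx filter_uniq.
move=> x; rewrite inE mem_filter => /orP[/eqP-> //|/andP[_]]; exact: Sub.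
Qed.

Lemma set_nth_upd (rs : seq N) (R : nat -> nat) rd v :
  (forall r, nth N0 rs r = N.of_nat (R r)) ->
  forall r, nth N0 (set_nth N0 rs rd (N.of_nat v)) r = N.of_nat (upd R rd v r).
Proof. by move=> H r; rewrite nth_set_nth /= updE; case: eqP. Qed.

(** * Simulation of the word RAM by the machine on natural numbers *)

Section Simulation.

Variables (p : program) (w nregs nmem ntabs : nat) (keys : nat -> seq nat).
Hypothesis w_gt0 : 0 < w.

Definition binop_safe (op : binop) (x y : nat) : Prop :=
  match op with
  | Add | Mul | Shl => nat_binop op x y < 2 ^ w
  | Sub => y <= x
  | Div | Mod => True
  | _ => False
  end.

(* Excludes overflow and confines the space: memory is written below [nmem], and
   table [h] only receives keys from the list [keys h]. *)
Definition safe (i : instr) (s : mstate) : Prop :=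
  match i with
  | Const rd v => rd < nregs /\ N.to_nat v < 2 ^ w
  | Op op rd r1 r2 => rd < nregs /\ binop_safe op (mreg s r1) (mreg s r2)
  | Read rd _ => rd < nregs
  | Write ra _ => mreg s ra < nmem
  | Insert h rk _ => h < ntabs /\ mreg s rk \in keys h
  | Delete _ _ => False
  | Lookup _ rd rf _ => rd < nregs /\ rf < nregs
  | _ => True
  end.

Definition next (c : nat * mstate) : nat * mstate :=
  let i := nth Halt p c.1 in (next_pc i c.1 c.2, exec1 i c.2).

Fixpoint reach (t : nat) (c c' : nat * mstate) : Prop :=
  if t is t'.+1 then safe (nth Halt p c.1) c.2 /\ reach t' (next c) c'
  else c = c'.

Lemma reach_trans t1 t2 c1 c2 c3 :
  reach t1 c1 c2 -> reach t2 c2 c3 -> reach (t1 + t2) c1 c3.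
Proof.
by elim: t1 c1 => [|t IH] c1 /=; [move=> -> | case=> ? H1 H2; split; auto].
Qed.

Fixpoint block_safe (b : seq instr) (s : mstate) : Prop :=
  if b is i :: b' then safe i s /\ block_safe b' (exec1 i s) else True.

Lemma reach_block b pc s :
  take (size b) (drop pc p) = b -> all straight b -> block_safe b s ->
  reach (size b) (pc, s) (pc + size b, foldl (fun s i => exec1 i s) s b).
Proof.
elim: b pc s => [|i b IH] pc s /=; first by rewrite addn0.
move=> Hb /andP[si sb] [Si Sb].
have ltp : pc < size p.
  by rewrite ltnNge; apply/negP => /drop_oversize E; rewrite E in Hb.
move: Hb; rewrite (drop_nth Halt ltp) /= => -[Ei Eb].
rewrite Ei; split=> //; rewrite /next /= Ei.
have -> : next_pc i pc s = pc.+1 by case: (i) si.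
by rewrite -addSnnS; apply: IH; rewrite ?Eb.
Qed.

(** The last clause serves the space bound: a table is stored as a list without repeated keys, all
    from [keys h], so it is never longer than [keys h]. *)
Definition rep (st : state) (c : nat * mstate) : Prop :=
  let: (i, MState R M T) := c in
  [/\ pc st = i,
      [/\ forall r, reg st r = N.of_nat (R r), forall r, R r < 2 ^ w
        & size (regs st) <= nregs],
      [/\ forall a, cell st a = N.of_nat (M a), forall a, M a < 2 ^ w
        & size (mem st) <= nmem]
    & [/\ forall h k, tlookup (tab st h) (N.of_nat k) = omap N.of_nat (T h k),
          forall h k v, T h k = Some v -> v < 2 ^ w, size (tabs st) <= ntabs
        & forall h, uniq (map fst (tab st h)) /\
             {subset map fst (tab st h) <= map N.of_nat (keys h)}]].

Lemma wrap_of_nat x : x < 2 ^ w -> wrap w (N.of_nat x) = N.of_nat x.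
Proof. by move=> lt_x; rewrite /wrap N.mod_small // pow2_of_nat; lia. Qed.

Lemma nat_binop_lt op x y :
  x < 2 ^ w -> y < 2 ^ w -> binop_safe op x y -> nat_binop op x y < 2 ^ w.
Proof.
case: op => //= ltx lty _; first exact: leq_ltn_trans (leq_subr _ _) ltx.
  exact: leq_ltn_trans (leq_div _ _) ltx.
exact: leq_ltn_trans (leq_mod _ _) ltx.
Qed.

Lemma eval_binop_of_nat op x y :
  x < 2 ^ w -> y < 2 ^ w -> binop_safe op x y ->
  eval_binop w op (N.of_nat x) (N.of_nat y) = N.of_nat (nat_binop op x y).
Proof.
move=> ltx lty safe_op; have lt := nat_binop_lt ltx lty safe_op.
move: safe_op lt; rewrite /eval_binop; case: op => //= safe_op lt.
- by rewrite -(wrap_of_nat lt); congr wrap; lia.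
- rewrite -(wrap_of_nat lt) /wrap pow2_of_nat.
  (* The RAM adds 2^w before subtracting; since y <= x the result is x - y plus one full modulus,
     which wrapping removes. *)
  rewrite (_ : (_ + _ - _)%num =
    (N.of_nat (x - y) + 1 * N.of_nat (2 ^ w))%num); last by lia.
  by rewrite N.Div0.mod_add.
- by rewrite -(wrap_of_nat lt); congr wrap; lia.
- by rewrite -(wrap_of_nat lt); congr wrap; rewrite div_of_nat.
- by rewrite -(wrap_of_nat lt); congr wrap; rewrite mod_of_nat.
- rewrite -(wrap_of_nat lt); congr wrap; rewrite N.shiftl_mul_pow2 pow2_of_nat.
  by lia.
Qed.

Lemma upd_lt (f : nat -> nat) k v : v < 2 ^ w -> (forall x, f x < 2 ^ w) ->
  forall x, upd f k v x < 2 ^ w.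
Proof. by move=> ltv ltf x; rewrite updE; case: eqP. Qed.

Lemma rep_step st c :
  rep st c -> safe (nth Halt p c.1) c.2 -> rep (step p w st) (next c).
Proof.
case: c => i [R M T]; case: st => i' rs ms ts.
case=> /= -> [HR ltR sR] [HM ltM sM] [HT ltT sT HK].
rewrite /reg /cell /tab /= in HR HM HT HK.
rewrite /next /rep /step /current_instr /=.
have sset S rd (x : S) l v k : rd < k -> size l <= k -> size (set_nth x l rd v) <= k.
  by move=> ltrd sl; rewrite size_set_nth geq_max ltrd.
case: (nth Halt p i) => /=; rewrite /reg /cell /tab /=.
- move=> rd v [ltrd ltv]; split=> //.
  rewrite /set_reg -{1}(N2Nat.id v) wrap_of_nat //.
  by split; [exact: set_nth_upd | exact: upd_lt | exact: sset].
- move=> op rd r1 r2 [ltrd so]; split=> //.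
  rewrite !HR eval_binop_of_nat //.
  split; [exact: set_nth_upd | | exact: sset].
  by apply: upd_lt => //; exact: nat_binop_lt.
- move=> rd ra ltrd; split=> //; rewrite HR Nat2N.id HM.
  by split; [exact: set_nth_upd | exact: upd_lt | exact: sset].
- move=> ra rv lta; split=> //; rewrite !HR Nat2N.id.
  by split; [exact: set_nth_upd | exact: upd_lt | exact: sset].
- move=> h rk rv [lth kS]; split=> //.
  rewrite !HR; split.
  + move=> h' k; rewrite nth_set_nth /= updE; case: eqP => // _.
    rewrite tlookup_tinsert updE HT.
    have -> : (N.of_nat k == N.of_nat (R rk)) = (k == R rk).
      by apply/eqP/eqP => [/Nat2N.inj|->].
    by case: eqP.
  + move=> h' k v; rewrite updE; case: eqP => _; last exact: ltT.
    by rewrite updE; case: eqP => [_ [<-]|_]; [exact: ltR|exact: ltT].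
  + exact: sset.
  + move=> h'; rewrite nth_set_nth /=; case: eqP => // ->.
    case: (HK h) => U S; apply: tinsert_keys => //.
    by apply/mapP; exists (R rk).
- by [].
- move=> h rd rf rk [ltrd ltrf]; rewrite HR HT.
  have -> : (if omap N.of_nat (T h (R rk)) is Some v then (v, 1%num) else (N0, N0))
     = (N.of_nat (odflt 0 (T h (R rk))), N.of_nat (isSome (T h (R rk)))).
    by case: (T h (R rk)).
  split=> //; split; [| |exact: (sset _ _ _ _ _ _ _ (sset _ _ _ _ _ _ _ _))].
    by rewrite /set_reg; apply: set_nth_upd; exact: set_nth_upd.
  apply: upd_lt; last apply: upd_lt => //.
    by apply: leq_ltn_trans (leq_b1 _) _; rewrite -{1}(expn0 2) ltn_exp2l.
  by case E: (T h (R rk)) => [v|] /=; [exact: ltT E | rewrite expn_gt0].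
- by [].
- move=> r1 r2 l _; split=> //; rewrite !HR.
  by have -> : N.ltb (N.of_nat (R r1)) (N.of_nat (R r2)) = (R r1 < R r2); first by lia.
- move=> r1 r2 l _; split=> //; rewrite !HR.
  have -> // : N.eqb (N.of_nat (R r1)) (N.of_nat (R r2)) = eqn (R r1) (R r2).
  by lia.
- by [].
Qed.

Lemma rep_space st c : rep st c ->
  space st <= nregs + nmem + \sum_(h < ntabs) (size (keys h)).+1.
Proof.
case: c => i [R M T] [_ [_ _ sR] [_ _ sM] [_ _ sT HK]].
rewrite /space; apply: leq_add; first exact: leq_add.
rewrite (big_nth [::]) big_mkord.
rewrite (leq_trans (n := \sum_(h < size (tabs st)) (size (keys h)).+1)) //.
  apply: leq_sum => h _; rewrite ltnS; case: (HK h) => U Sub.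
  by have := uniq_leq_size U Sub; rewrite !size_map.
rewrite -!(big_mkord xpredT (fun h => (size (keys h)).+1)).
by rewrite (big_cat_nat _ sT) //= leq_addr.
Qed.

Lemma reach_run t st c c' : rep st c -> reach t c c' ->
  rep (run p w t st) c' /\
  forall s, s <= t ->
    space (run p w s st) <= nregs + nmem + \sum_(h < ntabs) (size (keys h)).+1.
Proof.
have runS u st1 : run p w u.+1 st1 = run p w u (step p w st1).
  by rewrite /run iterSr.
elim: t st c => [|t IH] st c Hrep.
  by move=> <-; split=> // s; rewrite leqn0 => /eqP->; exact: rep_space Hrep.
case=> Sc Hr; have [Hr1 Hr2] := IH _ _ (rep_step Hrep Sc) Hr.
rewrite runS; split=> // -[_|s lts]; first exact: rep_space Hrep.
by rewrite runS; apply: Hr2.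
Qed.

End Simulation.

(** * Words and their codes *)

(** The head is the low-order digit, so prepending a letter is one multiplication and one addition,
    and a prefix of length i is split off by dividing by B^i. *)
Fixpoint code (B : nat) (s : seq nat) : nat :=
  if s is a :: s' then a + code B s' * B else 0.

Lemma code_cat B s t : code B (s ++ t) = code B s + code B t * B ^ size s.
Proof. by elim: s => [|a s IH] /=; rewrite ?muln1 // IH expnS; lia. Qed.

Lemma code_lt B s : all (fun a => a < B) s -> code B s < B ^ size s.
Proof.
elim: s => //= a s IH /andP[lta /IH lts]; rewrite expnS.
have : (code B s).+1 * B <= B ^ size s * B by rewrite leq_mul2r lts orbT.
by lia.
Qed.

Lemma code_cat_div B s t : all (fun a => a < B) s ->
  code B (s ++ t) %/ B ^ size s = code B t.
Proof.
move=> /code_lt lts; rewrite code_cat addnC divnMDl ?divn_small ?addn0 //.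
exact: leq_ltn_trans lts.
Qed.

Lemma code_cat_mod B s t : all (fun a => a < B) s ->
  code B (s ++ t) %% B ^ size s = code B s.
Proof. by move=> /code_lt lts; rewrite code_cat addnC modnMDl modn_small. Qed.

Lemma code_inj B s t :
  all (fun a => 0 < a < B) s -> all (fun a => 0 < a < B) t ->
  code B s = code B t -> s = t.
Proof.
elim: s t => [|a s IH] [|b t] //=; [by lia | by lia |].
move=> /andP[/andP[a0 aB] Hs] /andP[/andP[b0 bB] Ht] E.
have B0 : 0 < B by lia.
have Eab : a = b.
  have := congr1 (modn^~ B) E.
  by rewrite /= !(addnC _ (_ * B)) !modnMDl !modn_small.
rewrite Eab; congr cons; apply: IH => //; apply/eqP.
by rewrite -(eqn_pmul2r B0); apply/eqP; lia.
Qed.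

(** The last letter is the leading digit and is nonzero, so the length of a word can be read off the
    size of its code. *)
Lemma leq_exp_code B d s : 1 < B -> all (fun a => 0 < a < B) s ->
  (B ^ d <= code B s) = (d < size s).
Proof.
move=> B1 Hs; have lts : code B s < B ^ size s.
  by apply: code_lt; apply: sub_all Hs => a /andP[].
case: (leqP (size s) d) => [les|ltd].
  apply/negbTE; rewrite -ltnNge; apply: leq_trans lts _.
  by rewrite leq_exp2l.
elim: d s Hs ltd {lts} => [|d IH] [|a s] //= /andP[/andP[a0 aB] Hs] lt; first by lia.
by have := IH s Hs lt; rewrite expnS; nia.
Qed.

(** * Lehmer codes and order-isomorphism *)

(** Each digit is shifted by one to be nonzero, as [code_inj] requires. *)
Fixpoint lehmer (s : seq nat) : seq nat :=
  if s is b :: s' then (count (fun c => c < b) s').+1 :: lehmer s' else [::].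

Lemma size_lehmer s : size (lehmer s) = size s.
Proof. by elim: s => //= b s ->. Qed.

Lemma order_isomorphicP s t : size s = size t ->
  reflect (forall i j, i < size s -> j < size s ->
             (nth 0 s i < nth 0 s j) = (nth 0 t i < nth 0 t j))
          (order_isomorphic s t).
Proof.
rewrite /order_isomorphic => -> ; rewrite eqxx; apply: (iffP forallP) => /= H.
  by move=> i j lti ltj; have /forallP /(_ (Ordinal ltj)) /eqP := H (Ordinal lti).
by move=> i; apply/forallP => j; apply/eqP; apply: H.
Qed.

Lemma order_isomorphic_size s t : order_isomorphic s t -> size s = size t.
Proof. by case/andP=> /eqP. Qed.

(* Lehmer codes determine the order type: whether a letter of [s] is below [a] can
   be read off its rank in [s] and the number of letters below [a]. *)
Lemma count_ltn_nth s j a : j < size s ->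
  (nth 0 s j < a) =
  (count (fun c => c < nth 0 s j) s < count (fun c => c < a) s).
Proof.
move=> ltj; case: (leqP a (nth 0 s j)) => [lea|lta].
  apply/esym/negbTE; rewrite -leqNgt; apply: sub_count => c /= ltc.
  exact: leq_trans lea.
have E P : count P s = count P (take j s) + (P (nth 0 s j) + count P (drop j.+1 s)).
  by rewrite -{1}(cat_take_drop j s) (drop_nth 0 ltj) count_cat.
rewrite !E ltnn lta add0n addnCA ltnS; apply/esym.
by apply: leq_add; apply: sub_count => c /= ltc; exact: ltn_trans lta.
Qed.

Lemma count_order_isomorphic s t a b : size s = size t ->
  (forall j, j < size s -> (nth 0 s j < a) = (nth 0 t j < b)) ->
  count (fun c => c < a) s = count (fun c => c < b) t.
Proof.
elim: s t => [|x s IH] [|y t] //= [sz] H.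
by rewrite (H 0) // (IH t) // => j ltj; exact: (H j.+1).
Qed.

(** By induction the tails are order-isomorphic, so corresponding tail letters have equal ranks;
    together with equal first digits, [count_ltn_nth] then decides every comparison with the heads
    in the same way. *)
Lemma order_isomorphic_lehmer s t : uniq s -> uniq t ->
  order_isomorphic s t = (lehmer s == lehmer t).
Proof.
elim: s t => [|a s IH] [|b t].
- by move=> _ _; rewrite eqxx; apply/order_isomorphicP.
- by move=> _ _; apply/negbTE/negP => /order_isomorphic_size.
- by move=> _ _; apply/negbTE/negP => /order_isomorphic_size.
move=> /= /andP[nas us] /andP[nbt ut]; rewrite eqseq_cons eqSS.
case: (eqVneq (size s) (size t)) => [sz|nsz]; last first.
  apply/idP/andP=> [/order_isomorphic_size /= [E]|[_ /eqP E]].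
    by rewrite E eqxx in nsz.
  by move: nsz; rewrite -[size s]size_lehmer -[size t]size_lehmer E eqxx.
have szS : size (a :: s) = size (b :: t) by rewrite /= sz.
rewrite -IH //; apply/idP/andP => [/(order_isomorphicP szS) H|].
  split; last by apply/order_isomorphicP => // i j lti ltj; exact: (H i.+1 j.+1).
  by apply/eqP/count_order_isomorphic => // j ltj; exact: (H j.+1 0).
case=> /eqP Ec /(order_isomorphicP sz) H.
have Hlt j : j < size s -> (nth 0 s j < a) = (nth 0 t j < b).
  move=> ltj; rewrite !count_ltn_nth -?sz // Ec; congr (_ < _).
  by apply: count_order_isomorphic => // i lti; exact: H.
(* The opposite comparison is the negation of [Hlt], because the head differs from every letter of
   the tail. *)
have Hgt j : j < size s -> (a < nth 0 s j) = (b < nth 0 t j).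
  move=> ltj.
  have na : nth 0 s j != a by apply: contraNneq nas => <-; exact: mem_nth.
  have nb : nth 0 t j != b by apply: contraNneq nbt => <-; rewrite mem_nth -?sz.
  by have := Hlt j ltj; lia.
apply/(order_isomorphicP szS).
by case=> [|i] [|j] //= lti ltj; rewrite ?ltnn //; [exact: Hgt | exact: Hlt | exact: H].
Qed.

(** * Search trees: their nodes, leaves and sizes *)

(* Preorder of the search tree whose root is [y] and whose edges prepend an unused
   letter from [r], down to depth [e]. *)
Fixpoint nodes (e : nat) (r y : seq nat) : seq (seq nat) :=
  y :: if e is e'.+1
       then flatten [seq nodes e' (rem b r) (b :: y) | b <- r] else [::].

Fixpoint leaves (m : nat) (r u : seq nat) : seq (seq nat) :=
  if m is m'.+1
  then flatten [seq leaves m' (rem b r) (b :: u) | b <- r] else [:: u].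

(** In closed form, the sum of m! / (m - i)! over 0 <= i <= min(e, m). *)
Fixpoint node_count (e m : nat) : nat :=
  if e is e'.+1 then (m * node_count e' m.-1).+1 else 1.

(* Total size of the trees of depth [e] hanging at all nodes of the full search tree
   with [m] unused letters. *)
Fixpoint visit_count (e m : nat) : nat :=
  node_count e m + if m is m'.+1 then m * visit_count e m' else 0.

Lemma size_nodes e r y : size (nodes e r y) = node_count e (size r).
Proof.
elim: e r y => //= e IH r y; congr _.+1; rewrite size_flatten /shape -map_comp.
rewrite sumnE big_map -(@sum1_size _ r) big_distrl /= big_seq [RHS]big_seq.
by apply: eq_bigr => b br; rewrite IH mul1n size_rem // sum1_size.
Qed.

Lemma size_leaves r u : size (leaves (size r) r u) = (size r)`!.
Proof.
move Em: (size r) => m; elim: m r u Em => //= m IH r u Em.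
rewrite size_flatten /shape -map_comp sumnE big_map factS -Em.
rewrite -(@sum1_size _ r) big_distrl /= big_seq [RHS]big_seq.
by apply: eq_bigr => b br; rewrite IH ?mul1n // size_rem // Em.
Qed.

Lemma mem_nodes e r y z : uniq r ->
  z \in nodes e r y <->
  exists2 x, z = x ++ y & [&& size x <= e, uniq x & all [in r] x].
Proof.
elim: e r y z => [|e IH] r y z ur /=.
  rewrite inE; split=> [/eqP->|]; first by exists [::].
  by case=> -[|a x] -> //=.
rewrite inE; split=> [/orP[/eqP->|/flatten_mapP[b br]]|]; first by exists [::].
  case/IH; first exact: rem_uniq.
  move=> x -> /and3P[sx ux ax]; exists (rcons x b); first by rewrite cat_rcons.
  rewrite size_rcons ltnS sx rcons_uniq ux andbT all_rcons /= br /=.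
  apply/andP; split.
    by apply/negP => /(allP ax); rewrite /= mem_rem_uniqF.
  by apply: sub_all ax => c; exact: mem_rem.
case=> x ->; case/lastP: x => [|x b]; first by rewrite eqxx.
rewrite size_rcons ltnS rcons_uniq all_rcons cat_rcons.
move=> /and3P[sx /andP[nb ux] /andP[br ax]]; apply/orP; right.
apply/flatten_mapP; exists b => //; apply/IH; first exact: rem_uniq.
exists x => //; rewrite sx ux /=; apply/allP => c cx; rewrite /= mem_rem_uniq //.
rewrite !inE; apply/andP; split; last exact: (allP ax).
by apply: contraNneq nb => <-.
Qed.

Lemma mem_nodes0 e r y : uniq r ->
  (y \in nodes e r [::]) = [&& size y <= e, uniq y & all [in r] y].
Proof.
move=> ur; apply/idP/idP => [/(mem_nodes _ _ _ ur)[x ->]|H].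
  by rewrite cats0.
by apply/mem_nodes => //; exists y; rewrite ?cats0.
Qed.

Lemma mem_leaves r u x : perm_eq x r -> x ++ u \in leaves (size r) r u.
Proof.
move Em: (size r) => m; elim: m r u x Em => [|m IH] r u x Em pxr /=.
  have := perm_size pxr; rewrite Em; case: x {pxr} => // _.
  by rewrite inE.
have: size x = m.+1 by rewrite (perm_size pxr).
case/lastP: x pxr => // x b pxr; rewrite size_rcons => -[sx].
have br : b \in r by rewrite -(perm_mem pxr) mem_rcons mem_head.
apply/flatten_mapP; exists b => //; rewrite cat_rcons; apply: IH.
  by rewrite size_rem // Em.
rewrite -(perm_cons b); apply: perm_trans (perm_to_rem br).
by rewrite -perm_rcons.
Qed.

(** Every permutation of [r] occurs among the leaves and there are just (size r)! leaves, so none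
    occurs twice. *)
Lemma perm_leaves r : uniq r ->
  perm_eq (leaves (size r) r [::]) (permutations r).
Proof.
move=> ur.
have sub : {subset permutations r <= leaves (size r) r [::]}.
  by move=> x; rewrite mem_permutations => /mem_leaves-/(_ [::]); rewrite cats0.
have le : size (leaves (size r) r [::]) <= size (permutations r).
  by rewrite size_leaves size_permutations.
have up := permutations_uniq r.
rewrite perm_sym; apply: uniq_perm => //; first exact: leq_size_uniq up sub le.
by have [] := uniq_min_size up sub le.
Qed.

Lemma node_count_gt0 e m : 0 < node_count e m.
Proof. by case: e. Qed.

Lemma node_count_leq e m m' : m <= m' -> node_count e m <= node_count e m'.
Proof.
elim: e m m' => //= e IH m m' le; rewrite ltnS leq_mul //; apply: IH; lia.
Qed.

(** Each of the e + 1 levels has at most m^e nodes. *)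
Lemma node_count_exp e m : 0 < m -> node_count e m <= e.+1 * m ^ e.
Proof.
move=> m0; elim: e => //= e IH.
have : m * node_count e m.-1 <= m * (e.+1 * m ^ e).
  by rewrite leq_mul2l (leq_trans (node_count_leq e (leq_pred m)) IH) orbT.
have : 0 < m ^ e.+1 by rewrite expn_gt0 m0.
by rewrite expnS; nia.
Qed.

(** The sum of the 1/i! is below 3. In the induction the strict inequality, multiplied by the number
    of letters, absorbs the root; this takes at least two letters, so smaller m are separate. *)
Lemma node_count_fact e m : node_count e m < 3 * m`!.
Proof.
elim: e m => [|e IH] m; first by have := fact_gt0 m; rewrite /=; lia.
case: m => [|[|m]] //.
  by rewrite (_ : node_count e.+1 1 = 2) //=; case: (e) => //= e'; rewrite mul0n.
have := IH m.+1; rewrite [m.+2`!]factS /=; nia.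
Qed.

(** Counting pairs (u, y): those with empty y are counted by the nodes of the full tree; in the
    others one letter of y is chosen freely, and a pair on the remaining m letters with shorter y is
    left. *)
Lemma visit_count_S e m :
  visit_count e.+1 m.+1 = node_count m.+1 m.+1 + m.+1 * visit_count e m.
Proof.
have H m' : visit_count 0 m' = node_count m' m' by elim: m' => //= m' ->.
elim: m => [|m IH]; first by rewrite /=; lia.
have -> : visit_count e.+1 m.+2 = node_count e.+1 m.+2 + m.+2 * visit_count e.+1 m.+1 by [].
have E : visit_count e m.+1 = node_count e m.+1 + m.+1 * visit_count e m by [].
rewrite IH E /=; lia.
Qed.

(** Each of the e + 1 possible lengths of y contributes at most as many pairs as the full search
    tree has nodes. *)
Lemma visit_count_leq e m : visit_count e m <= e.+1 * (3 * m`!).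
Proof.
have : visit_count e m <= e.+1 * node_count m m.
  elim: e m => [|e IH] [|m].
  - by [].
  - by rewrite mul1n; elim: m.+1 => //= m' IH; rewrite add1n ltnS leq_mul2l IH orbT.
  - by rewrite /=; lia.
  - rewrite visit_count_S; have := IH m => /=; nia.
move=> H; apply: leq_trans H _; rewrite leq_mul2l; apply/orP; right.
exact: ltnW (node_count_fact _ _).
Qed.

(** * The recurrence for the number of hits *)

(* This is [h(u, y)] in the notation of the header. *)
Fixpoint hits (Pi : seq (seq nat)) (u y : seq nat) : nat :=
  if u is a :: u' then hits Pi u' y + hits Pi u' (rcons y a)
  else has (order_isomorphic y) Pi.

(** The two terms of the recurrence correspond to the value of the first bit of the mask: the first
    letter of [u] is skipped or joins [y]. *)
Lemma hits_card Pi u y :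
  hits Pi u y =
  #|[set b : (size u).-tuple bool | has (order_isomorphic (y ++ mask b u)) Pi]|.
Proof.
elim: u y => [|a u IH] y /=.
  have -> : [set b : 0.-tuple bool | has (order_isomorphic (y ++ mask b [::])) Pi]
            = if has (order_isomorphic y) Pi then setT else set0.
    by apply/setP => b; rewrite inE mask0 cats0; case: has; rewrite !inE.
  by case: has; rewrite ?cards0 ?cardsT ?card_tuple ?card_bool.
rewrite !IH -!sum1dep_card.
rewrite (reindex (fun x : bool * (size u).-tuple bool => [tuple of x.1 :: x.2])) /=.
  pose F (b : bool) (x : (size u).-tuple bool) :=
    if has (order_isomorphic (y ++ mask (b :: x) (a :: u))) Pi then 1 else 0.
  transitivity (\sum_(b : bool) \sum_x F b x); last first.
    by rewrite pair_bigA [RHS]big_mkcond; apply: eq_bigr => -[[] x] _.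
  rewrite big_bool /= addnC; congr (_ + _); rewrite big_mkcond //.
  by apply: eq_bigr => b _; rewrite cat_rcons.
exists (fun t => (thead t, behead_tuple t)) => [[b x] _|t _] /=.
  by congr (_, _); apply: val_inj.
by rewrite -tuple_eta.
Qed.

Lemma num_hits_filter Pi n tau : size tau <= n ->
  num_hits Pi tau = hits [seq p <- Pi | size p <= n] tau [::].
Proof.
move=> sz; rewrite hits_card; apply: eq_card => b; rewrite !inE /is_hit /=.
apply/hasP/hasP => -[p pP H]; exists p => //; last first.
  by move: pP; rewrite mem_filter => /andP[].
rewrite mem_filter pP andbT -(order_isomorphic_size H).
by apply: leq_trans sz; rewrite size_mask ?size_tuple // -{2}(size_tuple b) count_size.
Qed.

Lemma hits_eq0 Pi K u y : (forall x, x \in Pi -> size x <= K) ->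
  K < size y -> hits Pi u y = 0.
Proof.
move=> HK; elim: u y => [|a u IH] y /= lt; last by rewrite !IH // size_rcons leqW.
apply/eqP; rewrite eqb0; apply/hasPn => x /HK szx.
by apply: contraTN lt => /order_isomorphic_size ->; rewrite -leqNgt.
Qed.

(** [node_count] satisfies the recurrence of [hits] as an inequality. The bound determines the
    extent of the array of counters and rules out hits beyond it. *)
Lemma hits_leq Pi K u y : (forall x, x \in Pi -> size x <= K) ->
  hits Pi u y <= node_count (K - size y) (size u).
Proof.
move=> HK; elim: u y => [|a u IH] y /=.
  by rewrite (leq_trans (leq_b1 _)) ?node_count_gt0.
case: (leqP K (size y)) => leK.
  rewrite (hits_eq0 (y := rcons y a) _ HK) ?size_rcons // addn0.
  by apply: leq_trans (IH y) _; exact: node_count_leq.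
have := IH y; have := IH (rcons y a); rewrite size_rcons.
have -> : K - size y = (K - (size y).+1).+1 by lia.
set e := K - (size y).+1 => /= H1 H2.
have : size u * node_count e (size u).-1 <= size u * node_count e (size u).
  by rewrite leq_mul2l node_count_leq ?orbT // leq_pred.
lia.
Qed.

(** * The program *)

(* [rz] and [rlc] hold the code and the Lehmer code of the current word [y ++ u],
   [rrem] the code of the increasing list of unused letters, [rN] its length,
   [rd] and [rlev] the lengths of [y ++ u] and of [u].  [rf] is 1 while [y] varies
   and 0 while [u] varies.  [rph] is the phase: 0 collects the Lehmer codes of the
   patterns in table 1, 1 fills level 0 of table 2, 2 is the main search. *)
Local Notation rbase := 0 (only parsing).
Local Notation rlen := 1 (only parsing).
Local Notation zero := 2 (only parsing).
Local Notation one := 3 (only parsing).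
Local Notation rn := 4 (only parsing).
Local Notation rB := 5 (only parsing).
Local Notation rbw := 6 (only parsing).
Local Notation rmax := 7 (only parsing).
Local Notation rz := 8 (only parsing).
Local Notation rlc := 9 (only parsing).
Local Notation rrem := 10 (only parsing).
Local Notation rN := 11 (only parsing).
Local Notation rd := 12 (only parsing).
Local Notation rlev := 13 (only parsing).
Local Notation ri := 14 (only parsing).
Local Notation rf := 15 (only parsing).
Local Notation rph := 16 (only parsing).
Local Notation rP := 17 (only parsing).
Local Notation rt := 18 (only parsing).
Local Notation rb := 19 (only parsing).
Local Notation ry := 20 (only parsing).
Local Notation rv := 21 (only parsing).
Local Notation rjunk := 22 (only parsing).

Local Notation l_width := 6 (only parsing).
Local Notation l_patterns := 10 (only parsing).
Local Notation l_next := 15 (only parsing).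
Local Notation l_letters := 17 (only parsing).
Local Notation l_letter := 18 (only parsing).
Local Notation l_start := 23 (only parsing).
Local Notation l_enter := 25 (only parsing).
Local Notation l_phase0 := 46 (only parsing).
Local Notation l_phase1 := 50 (only parsing).
Local Notation l_limit := 53 (only parsing).
Local Notation l_loop := 55 (only parsing).
Local Notation l_push := 56 (only parsing).
Local Notation l_pushed := 71 (only parsing).
Local Notation l_up := 75 (only parsing).
Local Notation l_restart := 88 (only parsing).
Local Notation l_ascend := 90 (only parsing).
Local Notation l_pop := 92 (only parsing).
Local Notation l_length := 109 (only parsing).
Local Notation l_halt := 113 (only parsing).

Definition b_init : program :=
  [:: Const one 1; Read rn zero; Read rt one; Const ri 2; Op Add rbase rt ri;
      Const rB 1].

Definition b_double : program :=
  [:: Op Add rB rB rB; Op Add rbw rbw one].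

Definition b_pattern : program :=
  [:: Read rv ri; Insert 0 rv one].

Definition b_max : program :=
  [:: Op Add rmax rv zero].

Definition b_next : program :=
  [:: Op Add ri ri one].

Definition b_top : program :=
  [:: Op Add rb rn zero].

Definition b_letter : program :=
  [:: Op Mul rrem rrem rB; Op Add rrem rrem rb; Op Sub rb rb one].

Definition b_start : program :=
  [:: Op Add rN rn zero; Const rf 1].

Definition b_split : program :=
  [:: Op Sub rt rd rlev; Op Mul rt rt rbw; Op Shl rP one rt].

(** Division by [rP], the power B^|y|, separates y from u = a u'. The level is the low-order digit
    of a key, so subtracting 1 from the keys of y a and y leads to the two entries one level
    down. *)
Definition b_update : program :=
  [:: Op Mod ry rz rP; Op Div rt rz rP; Op Mod rb rt rB; Op Mul rt rb rP;
      Op Add rt rt ry; Op Mul rt rt rB; Op Add rt rt rlev; Op Sub rt rt one;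
      Lookup 2 rv rjunk rt; Op Mul ry ry rB; Op Add ry ry rlev;
      Op Sub rt ry one; Lookup 2 rt rjunk rt; Op Add rv rv rt; Insert 2 ry rv].

Definition b_is_pattern : program :=
  [:: Lookup 0 rv rjunk rz].

Definition b_mark : program :=
  [:: Insert 1 rlc one].

Definition b_base : program :=
  [:: Lookup 1 rv rjunk rlc; Op Mul ry rz rB; Insert 2 ry rv].

Definition b_first : program :=
  [:: Const ri 0].

Definition b_push : program :=
  [:: Op Mul rP ri rbw; Op Shl rP one rP; Op Div rt rrem rP; Op Mod rb rt rB;
      Op Div rt rt rB; Op Mul rt rt rP; Op Mod rrem rrem rP;
      Op Add rrem rrem rt; Op Mul rz rz rB; Op Add rz rz rb; Op Sub rb rb ri;
      Op Mul rlc rlc rB; Op Add rlc rlc rb; Op Add rd rd one; Op Sub rN rN one].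

Definition b_deeper : program :=
  [:: Op Add rlev rlev one; Const rf 1].

Definition b_outer : program :=
  [:: Const rph 2; Const rf 0; Const ri 0].

Definition b_leaf : program :=
  [:: Lookup 2 rv rjunk rlev; Op Add rt rbase rv; Read rv rt;
      Op Add rv rv one; Write rt rv].

Definition b_phase1 : program :=
  [:: Const rph 1].

Definition b_shallower : program :=
  [:: Op Sub rlev rlev one].

Definition b_pop : program :=
  [:: Op Mod rb rz rB; Op Div rz rz rB; Op Mod rt rlc rB; Op Div rlc rlc rB;
      Op Sub ri rb rt; Op Mul rP ri rbw; Op Shl rP one rP; Op Div rt rrem rP;
      Op Mul rt rt rB; Op Add rt rt rb; Op Mul rt rt rP; Op Mod rrem rrem rP;
      Op Add rrem rrem rt; Op Sub rd rd one; Op Add rN rN one;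
      Op Add ri ri one].

(* The length 2^(bw (n + 2)) exceeds every number of hits; the cells of the array that
   were never written hold 0. *)
Definition b_length : program :=
  [:: Op Add rt rn one; Op Add rt rt one; Op Mul rt rt rbw; Op Shl rlen one rt].

Definition prog : program :=
  b_init ++
  [:: JumpLt rn rB l_patterns] ++
  b_double ++
  [:: Jump l_width; JumpEq ri rbase l_letters] ++
  b_pattern ++
  [:: JumpLt rv rmax l_next] ++
  b_max ++
  b_next ++
  [:: Jump l_patterns] ++
  b_top ++
  [:: JumpEq rb zero l_start] ++
  b_letter ++
  [:: Jump l_letter] ++
  b_start ++
  b_split ++
  [:: JumpEq rph zero l_phase0; JumpEq rph one l_phase1] ++
  b_update ++
  [:: Jump l_limit] ++
  b_is_pattern ++
  [:: JumpEq rv zero l_limit] ++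
  b_mark ++
  [:: Jump l_limit] ++
  b_base ++
  [:: JumpLt rmax rP l_up] ++
  b_first ++
  [:: JumpEq ri rN l_up] ++
  b_push ++
  [:: JumpEq rf one l_enter] ++
  b_deeper ++
  [:: Jump l_enter; JumpEq rf zero l_ascend; JumpLt rlev rd l_pop;
      JumpEq rph zero l_restart] ++
  b_outer ++
  [:: JumpLt zero rN l_loop] ++
  b_leaf ++
  [:: Jump l_ascend] ++
  b_phase1 ++
  [:: Jump l_enter; JumpEq rlev zero l_length] ++
  b_shallower ++
  b_pop ++
  [:: Jump l_loop] ++
  b_length ++
  [:: Halt].

(** * Correctness and running time of the program *)

Section Program.

Variables (n w : nat) (Ps : seq (seq nat)).
Hypothesis n_gt0 : 0 < n.
Hypothesis w_large : 8 * (n * block_width n) <= w.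

Let bw := block_width n.
Let B := 2 ^ bw.
Let K := \max_(q <- Ps) size q.
Let maxc := \max_(q <- Ps) code B q.
Let base := (size Ps).+2.
Let W := nodes K (iota 1 n) [::].
(** The counters start right behind the input, at [base]; there is one for each value from 0 to the
    bound of [hits_leq]. *)
Let nmem := base + (node_count K n).+1.
Let key (j : nat) (y : seq nat) := code B y * B + j.

Definition keys (h : nat) : seq nat :=
  match h with
  | 0 => [seq code B q | q <- Ps]
  | 1 => [seq code B (lehmer y) | y <- W]
  | 2 => [seq key j y | j <- iota 0 n.+1, y <- W]
  | _ => [::]
  end.

Notation reach := (reach prog w 23 nmem 3 keys).

(** Time-bounded reachability in continuation style: a lemma on a piece of code with cost b turns a
    budget c for what follows it into the budget b + c. *)
Definition wp (b : nat) (c : nat * mstate) (Q : nat * mstate -> Prop) : Prop :=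
  exists t c', [/\ t <= b, reach t c c' & Q c'].

Lemma wp_done b c (Q : nat * mstate -> Prop) : Q c -> wp b c Q.
Proof. by exists 0, c. Qed.

Lemma wp_le b b' c Q : b <= b' -> wp b c Q -> wp b' c Q.
Proof.
by move=> le [t [c' [let' ? ?]]]; exists t, c'; split=> //; exact: leq_trans le.
Qed.

Lemma wp_block blk b pc s Q :
  take (size blk) (drop pc prog) = blk -> all straight blk ->
  block_safe w 23 nmem 3 keys blk s ->
  (let s' := foldl (fun s i => exec1 i s) s blk in
   wp b (pc + size blk, MState (mreg s') (mmem s') (mtab s')) Q) ->
  wp (size blk + b) (pc, s) Q.
Proof.
move=> Eb sb Sb /=.
set s' := foldl _ _ _; rewrite (_ : MState _ _ _ = s'); last by case: s'.
move=> [t [c' [le r q]]]; exists (size blk + t), c'; split=> //.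
  by rewrite leq_add2l.
exact: reach_trans (reach_block Eb sb Sb) r.
Qed.

Lemma wp_jump b pc s l Q :
  nth Halt prog pc = Jump l -> wp b (l, s) Q -> wp b.+1 (pc, s) Q.
Proof.
move=> E [t [c' [le r q]]]; exists t.+1, c'; split=> //=; rewrite E /next /= E.
by case: s r.
Qed.

Lemma wp_jumpeq b pc s r1 r2 l Q :
  nth Halt prog pc = JumpEq r1 r2 l ->
  wp b (if mreg s r1 == mreg s r2 then l else pc.+1, s) Q -> wp b.+1 (pc, s) Q.
Proof.
move=> E [t [c' [le r q]]]; exists t.+1, c'; split=> //=; rewrite E /next /= E.
by case: s r.
Qed.

Lemma wp_jumplt b pc s r1 r2 l Q :
  nth Halt prog pc = JumpLt r1 r2 l ->
  wp b (if mreg s r1 < mreg s r2 then l else pc.+1, s) Q -> wp b.+1 (pc, s) Q.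
Proof.
move=> E [t [c' [le r q]]]; exists t.+1, c'; split=> //=; rewrite E /next /= E.
by case: s r.
Qed.

Record inv (R : nat -> nat) (z r : seq nat) (lev f ph : nat) : Prop := Inv {
  inv_zero : R zero = 0;
  inv_one : R one = 1;
  inv_n : R rn = n;
  inv_B : R rB = B;
  inv_bw : R rbw = bw;
  inv_max : R rmax = maxc;
  inv_base : R rbase = base;
  inv_z : R rz = code B z;
  inv_lc : R rlc = code B (lehmer z);
  inv_rem : R rrem = code B r;
  inv_N : R rN = size r;
  inv_d : R rd = size z;
  inv_lev : R rlev = lev;
  inv_f : R rf = f;
  inv_ph : R rph = ph }.

Definition wf (z r : seq nat) : Prop := perm_eq (z ++ r) (iota 1 n) /\ sorted ltn r.

Lemma B_gt1 : 1 < B.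
Proof. by rewrite -{1}(expn0 2) ltn_exp2l. Qed.

Lemma n_ltB : n < B.
Proof. by rewrite /B /bw /block_width trunc_log_ltn. Qed.

Lemma bw_ltB : bw < B.
Proof. exact: ltn_expl. Qed.

(** For n >= 1, n + 6 <= 7 n < 8 n. The six spare digits leave room for keys, addresses and the
    array length. *)
Lemma expB_lt_w m : m <= n + 6 -> B ^ m < 2 ^ w.
Proof.
move=> lem; rewrite -expnM ltn_exp2l //; apply: leq_trans w_large.
have bw0 : 0 < bw by [].
by rewrite -/bw; nia.
Qed.

Lemma lt_w x m : m <= n + 6 -> x <= B ^ m -> x < 2 ^ w.
Proof. by move=> lem lex; apply: leq_ltn_trans lex (expB_lt_w lem). Qed.

Lemma pow_bw i : 2 ^ (i * bw) = B ^ i.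
Proof. by rewrite mulnC expnM. Qed.

Lemma wf_size z r : wf z r -> size z + size r = n.
Proof. by case=> /perm_size; rewrite size_cat size_iota. Qed.

Lemma wf_mem z r a : wf z r -> a \in z ++ r -> 0 < a <= n.
Proof. by case=> /perm_mem -> _; rewrite mem_iota add1n ltnS. Qed.

Lemma wf_uniq z r : wf z r -> uniq (z ++ r).
Proof. by case=> /perm_uniq -> _; rewrite iota_uniq. Qed.

Lemma wf_digits z r : wf z r -> all (fun a => 0 < a < B) (z ++ r).
Proof.
move=> H; apply/allP => a /(wf_mem H) /andP[-> le] /=.
exact: leq_ltn_trans le n_ltB.
Qed.

Lemma digits_lt s : all (fun a => 0 < a < B) s -> all (fun a => a < B) s.
Proof. by apply: sub_all => a /andP[]. Qed.

Lemma wf_push z r (b : nat) : wf z r -> b \in r -> wf (b :: z) (rem b r).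
Proof.
case=> H sr br; split; last by apply: subseq_sorted (rem_subseq _ _) sr; exact: ltn_trans.
apply: perm_trans H; rewrite -cat1s -catA perm_catCA perm_cat2l perm_sym.
exact: perm_to_rem.
Qed.

Lemma count_ltn_sorted (r : seq nat) (b : nat) :
  sorted ltn r -> b \in r -> count (fun c => c < b) r = index b r.
Proof.
elim: r => //= c r IH pr; have /allP lt_c := order_path_min ltn_trans pr.
rewrite inE eq_sym; case: eqP => [Ecb|_] /= br; last first.
  by rewrite IH ?(path_sorted pr) // lt_c.
rewrite Ecb ltnn add0n; apply/eqP; rewrite -leqn0 leqNgt -has_count.
apply/hasPn => a /lt_c /= lt_ca.
by rewrite -leqNgt -Ecb ltnW.
Qed.

(** Exactly b - 1 of the letters 1, ..., n are below b. Those in [z] make up the Lehmer digit, those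
    in the increasing list [r] are the ones standing before b. *)
Lemma wf_rank z r (b : nat) : wf z r -> b \in r ->
  b = (count (fun c => c < b) z).+1 + index b r.
Proof.
move=> Wf br; have [H sr] := Wf.
have /(wf_mem Wf) /andP[b0 bn] : b \in z ++ r by rewrite mem_cat br orbT.
rewrite -(count_ltn_sorted sr br) addSn -count_cat; have /permP -> := H.
have -> : n = b.-1 + (n - b.-1) by lia.
rewrite iotaD count_cat.
rewrite (_ : count _ (iota 1 b.-1) = b.-1); last first.
  rewrite -[RHS](size_iota 1); apply/eqP; rewrite -all_count; apply/allP => c.
  by rewrite mem_iota; lia.
rewrite (_ : count _ (iota _ _) = 0); first by lia.
apply/eqP; rewrite -leqn0 leqNgt -has_count; apply/hasPn => c.
by rewrite mem_iota; lia.
Qed.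

Lemma wf_split (r : seq nat) (b : nat) : b \in r ->
  exists r1 r2, [/\ r = r1 ++ b :: r2, size r1 = index b r & rem b r = r1 ++ r2].
Proof.
move=> br; exists (take (index b r) r), (drop (index b r).+1 r).
have lt : index b r < size r by rewrite index_mem.
rewrite remE size_take lt; split=> //.
by rewrite -{1}(cat_take_drop (index b r) r) (drop_nth 0 lt) nth_index.
Qed.

Lemma code_lt_w s m : all (fun a => a < B) s -> size s <= m -> m <= n + 6 ->
  code B s < 2 ^ w.
Proof.
move=> Hs szs lem; apply: (lt_w lem); apply: leq_trans (ltnW (code_lt Hs)) _.
by rewrite leq_exp2l // B_gt1.
Qed.

(** At most b - 1 distinct positive letters are below b, so the digit at b is at most b <= n < B. *)
Lemma lehmer_digits s : uniq s -> all (fun a => 0 < a <= n) s ->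
  all (fun a => 0 < a < B) (lehmer s).
Proof.
elim: s => //= b s IH /andP[nb us] /andP[/andP[b0 bn] Hs]; rewrite IH // andbT.
apply: leq_ltn_trans n_ltB; apply: leq_trans bn.
rewrite -(prednK b0) ltnS -[in X in _ <= X](size_iota 1 b.-1) -size_filter.
apply: uniq_leq_size => [|c]; first exact: filter_uniq.
by rewrite mem_filter mem_iota => /andP[lt /(allP Hs)]; lia.
Qed.

(** The explicit list of constants keeps arithmetic and [code] folded during symbolic execution. *)
Ltac sx := lazy beta iota zeta delta
    [foldl exec1 upd eqn mreg mmem mtab nat_binop block_safe safe
     binop_safe fst snd b_init b_double b_pattern b_max b_next b_top
     b_letter b_start b_split b_update b_is_pattern b_mark b_base b_first
     b_push b_deeper b_outer b_leaf b_phase1 b_shallower b_pop b_length].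

Ltac state_eval t := eval lazy beta iota zeta delta
    [foldl exec1 upd eqn mreg mmem mtab nat_binop block_safe safe
     binop_safe fst snd b_init b_double b_pattern b_max b_next b_top
     b_letter b_start b_split b_update b_is_pattern b_mark b_base b_first
     b_push b_deeper b_outer b_leaf b_phase1 b_shallower b_pop b_length] in t.

Ltac conjs := repeat match goal with
  | |- _ /\ _ => split
  | |- True => exact Logic.I
  | |- is_true (_ < 23) => exact isT
  | |- is_true (_ < 3) => exact isT
  | H : ?P |- ?P => exact H
  end.

Ltac irw I := rewrite ?(inv_zero I) ?(inv_one I) ?(inv_n I) ?(inv_B I) ?(inv_bw I)
  ?(inv_max I) ?(inv_base I) ?(inv_z I) ?(inv_lc I) ?(inv_rem I) ?(inv_N I)
  ?(inv_d I) ?(inv_lev I) ?(inv_f I) ?(inv_ph I).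

Ltac exec_block b :=
  apply: (wp_block (blk := b)); [by [] | by [] | sx | cbv zeta];
  [ | match goal with |- wp _ (_, MState _ ?M ?T) _ =>
      let M' := state_eval M in let T' := state_eval T in
      change M with M'; change T with T' end ].

Lemma wf_code_lt_w z r (s : seq nat) : wf z r -> all [in z ++ r] s -> size s <= n + 6 ->
  code B s < 2 ^ w.
Proof.
move=> Wf /allP sub szs; apply: (code_lt_w _ szs) => //.
apply/allP => a /sub az; have /allP := digits_lt (wf_digits Wf); exact.
Qed.

Lemma wf_lehmer_lt_w z r : wf z r -> code B (lehmer z) < 2 ^ w.
Proof.
move=> Wf; have uz := wf_uniq Wf; rewrite cat_uniq in uz; case/andP: uz => uz _.
have sz := wf_size Wf.
apply: (@code_lt_w _ n); rewrite ?size_lehmer; try lia.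
apply/digits_lt/lehmer_digits => //; apply/allP => a az; apply: (wf_mem Wf).
by rewrite mem_cat az.
Qed.

Lemma mul_bw_lt_w i : i <= n -> i * bw < 2 ^ w.
Proof.
move=> lei; apply: (@lt_w _ 2); first by lia.
rewrite expnS expn1; apply: leq_mul; last exact: ltnW bw_ltB.
exact: leq_trans lei (ltnW n_ltB).
Qed.

Lemma small_lt_w i : i <= n.+1 -> i < 2 ^ w.
Proof.
move=> lei; apply: (@lt_w _ 1); first by lia.
by rewrite expn1; exact: leq_trans lei n_ltB.
Qed.

(** * Pushing and popping a letter *)

(** With r = r1 b r2, quotient and remainder by B^|r1| isolate b and rejoin r1 with r2; by
    [wf_rank], b - |r1| is the new Lehmer digit. *)
Lemma push_ok R M T (z r : seq nat) lev f ph (b : nat) c Q :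
  inv R z r lev f ph -> wf z r -> b \in r -> R ri = index b r ->
  (forall R', inv R' (b :: z) (rem b r) lev f ph -> wp c (l_pushed, MState R' M T) Q) ->
  wp (15 + c) (l_push, MState R M T) Q.
Proof.
move=> I Wf br Ei H; have Wf' := wf_push Wf br.
have rank := wf_rank Wf br.
have szN := wf_size Wf; have szN' := wf_size Wf'.
have [r1 [r2 [Er sr1 Erem]]] := wf_split br.
have ltB : all (fun a => a < B) (z ++ r) by apply/digits_lt/(wf_digits Wf).
move: ltB; rewrite all_cat {1}Er all_cat /= => /and4P[ltz lt1 ltb lt2].
have EP : 2 ^ (index b r * bw) = B ^ size r1 by rewrite pow_bw sr1.
have B0 : 0 < B by apply: ltnW B_gt1.
have E1 : code B r %/ B ^ size r1 = b + code B r2 * B by rewrite Er code_cat_div.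
have E2 : code B r %% B ^ size r1 = code B r1 by rewrite Er code_cat_mod.
have E3 : (b + code B r2 * B) %% B = b by rewrite addnC modnMDl modn_small.
have E4 : (b + code B r2 * B) %/ B = code B r2.
  by rewrite addnC divnMDl // divn_small // addn0.
have E5 : code B r1 + code B r2 * B ^ size r1 = code B (rem b r).
  by rewrite Erem code_cat.
have E6 : b - index b r = (count (fun c => c < b) z).+1 by lia.
have lt_ir : index b r < size r by rewrite index_mem.
have szr : size (rem b r) = (size r).-1 by rewrite size_rem.
have L1 : code B (rem b r) < 2 ^ w.
  apply: (wf_code_lt_w Wf'); last by lia.
  by apply/allP => a ar; rewrite mem_cat ar orbT.
have L2 : b + code B z * B < 2 ^ w.
  apply: (wf_code_lt_w (s := b :: z) Wf'); last by rewrite /=; lia.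
  by apply/allP => a az; rewrite mem_cat az.
have /= L3 := wf_lehmer_lt_w Wf'.
exec_block b_push.
  irw I; rewrite Ei !mul1n !EP E1 E2 !E3 E4 E5 E6; conjs;
    clear E1 E2 E3 E4 E6 EP; try lia.
  - by apply: mul_bw_lt_w; lia.
  - by apply: expB_lt_w; lia.
  - by apply: small_lt_w; lia.
apply: H; constructor; sx; irw I; rewrite ?Ei ?mul1n ?EP ?E1 ?E2 ?E3 ?E4 ?E5 ?E6 //.
- by rewrite /= addnC.
- by rewrite /= addnC.
- by rewrite szr subn1.
- by rewrite /= addn1.
Qed.

Lemma pop_ok R M T (z r : seq nat) lev f ph (b : nat) c Q :
  inv R (b :: z) (rem b r) lev f ph -> wf z r -> b \in r ->
  (forall R', inv R' z r lev f ph -> R' ri = (index b r).+1 ->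
     wp c (l_loop, MState R' M T) Q) ->
  wp (17 + c) (l_pop, MState R M T) Q.
Proof.
move=> I Wf br H; have Wf' := wf_push Wf br.
have rank := wf_rank Wf br.
have szN := wf_size Wf; have szN' := wf_size Wf'.
have [r1 [r2 [Er sr1 Erem]]] := wf_split br.
have ltB : all (fun a => a < B) (z ++ r) by apply/digits_lt/(wf_digits Wf).
move: ltB; rewrite all_cat {1}Er all_cat /= => /and4P[ltz lt1 ltb lt2].
have EP : 2 ^ (index b r * bw) = B ^ size r1 by rewrite pow_bw sr1.
have B0 : 0 < B by apply: ltnW B_gt1.
have E1 : code B (rem b r) %/ B ^ size r1 = code B r2 by rewrite Erem code_cat_div.
have E2 : code B (rem b r) %% B ^ size r1 = code B r1 by rewrite Erem code_cat_mod.
have E3 : code B (b :: z) %% B = b by rewrite /= addnC modnMDl modn_small.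
have E4 : code B (b :: z) %/ B = code B z.
  by rewrite /= addnC divnMDl // divn_small // addn0.
set k := count (fun c => c < b) z in rank.
have ltk : k.+1 < B by lia.
have E3' : code B (lehmer (b :: z)) %% B = k.+1.
  by rewrite /= addnC modnMDl modn_small.
have E4' : code B (lehmer (b :: z)) %/ B = code B (lehmer z).
  by rewrite /= addnC divnMDl // divn_small // addn0.
have E5 : code B r1 + (code B r2 * B + b) * B ^ size r1 = code B r.
  by rewrite [in RHS]Er code_cat /= [b + _]addnC.
have E6 : b - k.+1 = index b r by lia.
have lt_ir : index b r < size r by rewrite index_mem.
have szr : size (rem b r) = (size r).-1 by rewrite size_rem.
have L1 : code B r < 2 ^ w.
  apply: (wf_code_lt_w Wf); last by lia.
  by apply/allP => a ar; rewrite mem_cat ar orbT.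
have Ppos : 0 < B ^ size r1 by rewrite expn_gt0 B0.
exec_block b_pop.
  irw I; rewrite !E3 !E3' !E6 !mul1n !EP E1 E2 E5; conjs;
    clear E1 E2 E3 E3' E4 E4' E6 EP; try lia.
  - by apply: mul_bw_lt_w; lia.
  - by apply: expB_lt_w; lia.
  - by nia.
  - by nia.
  - by rewrite /=; lia.
  - by apply: small_lt_w; lia.
  - by apply: small_lt_w; lia.
apply: (wp_jump (l := l_loop)) => //.
apply: H; [constructor|]; sx; irw I; rewrite ?E3 ?E3' ?E4 ?E4' ?E6 ?mul1n ?EP ?E1 ?E2 ?E5 //.
- by rewrite szr addn1 prednK // (leq_ltn_trans _ lt_ir).
- by rewrite /= subn1.
- by rewrite addn1.
Qed.

(** * The effect of one visit on the tables *)

Definition act (ph : nat) (u : seq nat) (T : nat -> nat -> option nat)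
    (y : seq nat) : nat -> nat -> option nat :=
  match ph with
  | 0 => if odflt 0 (T 0 (code B (y ++ u))) == 0 then T
         else upd T 1 (upd (T 1) (code B (lehmer (y ++ u))) (Some 1))
  | 1 => upd T 2 (upd (T 2) (code B (y ++ u) * B)
           (Some (odflt 0 (T 1 (code B (lehmer (y ++ u)))))))
  | _ => upd T 2 (upd (T 2) (key (size u) y)
           (Some (odflt 0 (T 2 (key (size u).-1 (rcons y (head 0 u)))) +
                  odflt 0 (T 2 (key (size u).-1 y)))))
  end.

(* The bound on the values is inherited by the recurrence, whatever stale entries it
   reads. *)
Record tables_ok (T : nat -> nat -> option nat) : Prop := TablesOk {
  tables_ok1 : forall k v, T 1 k = Some v -> v = 1;
  tables_ok2 : forall k v, T 2 k = Some v -> v <= 2 ^ (k %% B);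
  tables_keys : forall k v, T 2 k = Some v -> k \in keys 2 }.

(** Phases 0 and 1 prepare level 0 and run with [u] empty; the recurrence of phase 2 takes a letter
    off [u]. *)
Definition phase (ph : nat) (u : seq nat) : bool :=
  if ph < 2 then u == [::] else (ph == 2) && (u != [::]).

Lemma mem_W y : (y \in W) = [&& size y <= K, uniq y & all [in iota 1 n] y].
Proof. by rewrite mem_nodes0 // iota_uniq. Qed.

Lemma wf_mem_W y u r : wf (y ++ u) r -> size y <= K -> y \in W.
Proof.
move=> Wf szy; have := wf_uniq Wf; rewrite mem_W szy !cat_uniq.
move=> /andP[/andP[-> _] _] /=; apply/allP => a ay; rewrite /= mem_iota add1n ltnS.
by apply: (wf_mem Wf); rewrite !mem_cat ay.
Qed.

Lemma key_mem j y : j <= n -> y \in W -> key j y \in keys 2.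
Proof. by move=> lej yW; apply/allpairsP; exists (j, y); rewrite mem_iota. Qed.

Lemma key_mod j y : j <= n -> key j y %% B = j.
Proof. by move=> lej; rewrite modnMDl modn_small // (leq_ltn_trans lej n_ltB). Qed.

Lemma tables_ok_level T j y : tables_ok T -> j <= n ->
  odflt 0 (T 2 (key j y)) <= 2 ^ j.
Proof.
move=> Tok lej; case E: (T 2 (key j y)) => [v|] //=.
by have := tables_ok2 Tok E; rewrite key_mod.
Qed.

Lemma act_ok ph u r T y : phase ph u -> wf (y ++ u) r -> size y <= K ->
  tables_ok T -> tables_ok (act ph u T y).
Proof.
move=> Hph Wf szy Tok; have yW := wf_mem_W Wf szy.
have := wf_size Wf; rewrite size_cat => sz.
case: ph Hph => [|[|[|ph]]] //=; rewrite /phase /=.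
- move=> /eqP ->; case: eqP => // _; case: Tok => t1 t2 t3.
  split=> // k v; rewrite updE /= updE; case: eqP => _; [by case | exact: t1].
- move=> /eqP ->; rewrite cats0; case: Tok => t1 t2 t3.
  split=> // k v; rewrite updE /= updE; case: eqP => [-> [Ev]|_];
    [|exact: t2| |exact: t3]; rewrite -?Ev.
    by rewrite modnMl; case E: (T 1 _) => [x|] //=; rewrite (t1 _ _ E).
  by have := key_mem (leq0n n) yW; rewrite /key addn0.
- case: u Wf sz => // a u Wf /= sz _.
  have T1 := tables_ok_level (rcons y a) Tok (_ : size u <= n).
  have T2 := tables_ok_level y Tok (_ : size u <= n).
  case: Tok => t1 t2 t3.
  split=> // k v; rewrite updE /= updE; case: eqP => [-> [Ev]|_];
    [|exact: t2| |exact: t3]; rewrite -?Ev.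
    by rewrite key_mod ?expnS; [have := T1; have := T2; lia|lia].
  by apply: key_mem => //; lia.
Qed.

(** The longest path is that of phase 2: 3 steps for [b_split], two tests, 15 steps for [b_update]
    and a jump, 21 in all. *)
Lemma visit_ok R M T y u r ph c Q :
  inv R (y ++ u) r (size u) 1 ph -> wf (y ++ u) r -> size y <= K -> phase ph u ->
  tables_ok T ->
  (forall R', inv R' (y ++ u) r (size u) 1 ph -> R' rP = B ^ size y ->
     wp c (l_limit, MState R' M (act ph u T y)) Q) ->
  wp (21 + c) (l_enter, MState R M T) Q.
Proof.
move=> I Wf szy Hph Tok H; have yW := wf_mem_W Wf szy.
have sz := wf_size Wf; rewrite size_cat in sz.
have EP : 2 ^ ((size y + size u - size u) * bw) = B ^ size y by rewrite addnK pow_bw.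
have L1 : code B (y ++ u) * B < 2 ^ w.
  (* The product is the code of a word one letter longer; [code_lt_w] also admits the digit 0. *)
  have E : code B (y ++ u) * B = code B (0 :: y ++ u) by [].
  rewrite E; apply: (@code_lt_w _ n.+1); [| rewrite /= size_cat; lia | lia].
  rewrite /= (ltnW B_gt1) /=; have := digits_lt (wf_digits Wf).
  by rewrite all_cat => /andP[].
apply: (wp_le (b := 3 + (18 + c))); first by lia.
exec_block b_split.
  irw I; rewrite size_cat !mul1n !EP; conjs; try lia.
  - by apply: mul_bw_lt_w; lia.
  - by apply: expB_lt_w; lia.
match goal with |- wp _ (_, MState ?R' _ _) _ => set R1 := R' end.
have I1 : inv R1 (y ++ u) r (size u) 1 ph by constructor; rewrite /R1; sx; irw I.
have P1 : R1 rP = B ^ size y.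
  by rewrite /R1; sx; irw I; rewrite size_cat mul1n EP.
move: R1 I1 P1 => {I EP} R {}I EP.
apply: (wp_jumpeq (r1 := rph) (r2 := zero) (l := l_phase0)) => //=; irw I.
move: Hph H I; case: ph => [|[|[|ph]]] //; rewrite /phase /=.
- move=> /eqP Eu H I.
  apply: (wp_le (b := 1 + (4 + c))); first by lia.
  exec_block b_is_pattern; first by [].
  match goal with |- wp _ (_, MState ?R' _ _) _ => set R1 := R' end.
  have I1 : inv R1 (y ++ u) r (size u) 1 0 by constructor; rewrite /R1; sx; irw I.
  apply: (wp_jumpeq (r1 := rv) (r2 := zero) (l := l_limit)) => //=.
  have P1 : R1 rP = B ^ size y by rewrite /R1; sx.
  have -> : R1 21 = odflt 0 (T 0 (code B (y ++ u))) by rewrite /R1; sx; irw I.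
  irw I1; case: eqP H => [E|nE] H.
    by apply: (wp_le (b := c)); [lia | apply: H].
  exec_block b_mark.
    irw I1; conjs; apply/mapP; exists y => //.
    by rewrite Eu cats0.
  apply: (wp_jump (l := l_limit)) => //; irw I1.
  by apply: (wp_le (b := c)); [lia | apply: H].
- move=> /eqP Eu H I.
  apply: (wp_jumpeq (r1 := rph) (r2 := one) (l := l_phase1)) => //=; irw I => /=.
  apply: (wp_le (b := 3 + c)); first by lia.
  exec_block b_base.
    irw I; conjs.
    by have := key_mem (leq0n n) yW; rewrite /key addn0 Eu cats0.
  match goal with |- wp _ (_, MState ?R' _ ?T') _ => set R1 := R';
    have -> : T' = act 1 u T y end.
    by rewrite /act; sx; irw I.
  by apply: H; [constructor|]; rewrite /R1; sx; irw I.
- case: u Wf sz yW L1 {szy} => // a u Wf /= sz yW L1 _ H I.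
  apply: (wp_jumpeq (r1 := rph) (r2 := one) (l := l_phase1)) => //=; irw I => /=.
  apply: (wp_le (b := 15 + (1 + c))); first by lia.
  have ltB := digits_lt (wf_digits Wf).
  have /and4P[lty lta ltu _] : [&& all (fun a => a < B) y, a < B,
      all (fun a => a < B) u & all (fun a => a < B) r].
    by move: ltB; rewrite !all_cat /= -!andbA.
  have E1 : code B (y ++ a :: u) %% B ^ size y = code B y by rewrite code_cat_mod.
  have E2 : code B (y ++ a :: u) %/ B ^ size y = a + code B u * B.
    by rewrite code_cat_div.
  have E3 : (a + code B u * B) %% B = a by rewrite addnC modnMDl modn_small.
  have E4 : a * B ^ size y + code B y = code B (rcons y a).
    by rewrite -cats1 code_cat /= mul0n addn0 addnC.
  have L2 : key (size u).+1 (rcons y a) < 2 ^ w.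
    have -> : key (size u).+1 (rcons y a) = code B ((size u).+1 :: rcons y a).
      by rewrite /= addnC.
    apply: (@code_lt_w _ n.+1); [| rewrite /= size_rcons; lia | lia].
    by rewrite /= all_rcons lta lty !andbT; have := n_ltB; lia.
  have L3 : key (size u).+1 y <= key (size u).+1 (rcons y a).
    by rewrite leq_add2r -cats1 code_cat leq_mul2r leq_addr orbT.
  have B0 : 0 < B by exact: ltnW B_gt1.
  have E5 j : j.+1 - 1 = j by rewrite subn1.
  have E6 k j : k + j.+1 - 1 = k + j by rewrite addnS subn1.
  have L4 : code B (rcons y a) <= code B (rcons y a) * B by rewrite leq_pmulr.
  have L5 : a * B ^ size y <= code B (rcons y a) by rewrite -E4 leq_addr.
  have T1 := tables_ok_level (rcons y a) Tok (_ : size u <= n).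
  have T2 := tables_ok_level y Tok (_ : size u <= n).
  exec_block b_update.
    irw I; rewrite !EP !E1 !E2 !E3 !E4 !E6 -!/(key _ _).
    conjs; rewrite /key in L2 L3 *; try lia.
      have : 2 ^ (size u).+1 < 2 ^ w.
        by apply: leq_ltn_trans (expB_lt_w (_ : n <= _)); [
           rewrite -expnM leq_exp2l //; have : 0 < bw by []; nia | lia].
      by rewrite expnS; move: T1 T2; rewrite /key; lia.
    by apply: (key_mem (j := (size u).+1)) => //; lia.
  apply: (wp_jump (l := l_limit)) => //.
  match goal with |- wp _ (_, MState ?R' _ ?T') _ => set R1 := R';
    have -> : T' = act 2 (a :: u) T y end.
    by rewrite /act /key; sx; irw I; rewrite !EP !E1 !E2 !E3 !E4 !E6.
  by apply: H; [constructor|]; rewrite /R1; sx; irw I.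
Qed.

Hypothesis Ps_perm : forall q : seq nat,
  q \in Ps -> is_permutation (size q) q /\ size q <= n.

Lemma pattern_digits q : q \in Ps -> all (fun a => 0 < a < B) q.
Proof.
case/Ps_perm => /perm_mem H szq; apply/allP => a; rewrite H mem_iota.
by have := n_ltB; lia.
Qed.

(* Lets the program compare [|y|] with the length of the longest pattern without
   computing that length. *)
Lemma max_code_lt d : (maxc < B ^ d) = (K <= d).
Proof.
have B1 := B_gt1.
have le_d q : q \in Ps -> (code B q < B ^ d) = (size q <= d).
  by move=> qP; rewrite ltnNge leq_exp_code ?pattern_digits // -leqNgt.
have -> : (maxc < B ^ d) = (maxc <= (B ^ d).-1).
  by have : 0 < B ^ d by [rewrite expn_gt0 ltnW]; lia.
apply/bigmax_leqP_seq/bigmax_leqP_seq => H q qP _; have := H q qP isT.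
  by rewrite -le_d //; have : 0 < B ^ d by [rewrite expn_gt0 ltnW]; lia.
by rewrite -le_d //; lia.
Qed.

(** * The inner search *)

(** An edge costs 36 steps (loop test, 15 to push, a jump, two tests, 17 to pop) and a node at most
    24, which fits into 64 per node; no edge is charged to the root, whence the [- 36]. *)
Lemma inner_ok ph u e y r R M T c Q :
  e + size y = K -> inv R (y ++ u) r (size u) 1 ph -> wf (y ++ u) r ->
  phase ph u -> tables_ok T ->
  (forall R' T', inv R' (y ++ u) r (size u) 1 ph -> tables_ok T' ->
     T' = foldl (act ph u) T (nodes e r y) -> wp c (l_up, MState R' M T') Q) ->
  wp (64 * node_count e (size r) - 36 + c) (l_enter, MState R M T) Q.
Proof.
move=> Ee I Wf Hph; elim: e y r Ee R M T c Q I Wf => [|e IH] y r Ee R M T c Q I Wf Tok H.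
  apply: (wp_le (b := 21 + (1 + c))); first by rewrite /=; lia.
  apply: (visit_ok I Wf _ Hph Tok) => [|R' I' P']; first by lia.
  apply: (wp_jumplt (r1 := rmax) (r2 := rP) (l := l_up)) => //=.
  rewrite P' (inv_max I') max_code_lt -Ee leqnn.
  by apply: H => //=; apply: (act_ok Hph Wf) => //; lia.
apply: (wp_le (b := 21 + (2 + (64 * (size r * node_count e (size r).-1) + 1 + c)))).
  by rewrite /=; lia.
apply: (visit_ok I Wf _ Hph Tok) => [|R' I' P']; first by lia.
apply: (wp_jumplt (r1 := rmax) (r2 := rP) (l := l_up)) => //=.
rewrite P' (inv_max I') max_code_lt -Ee ifF; last by lia.
set T1 := act ph u T y.
have Tok1 : tables_ok T1 by apply: (act_ok Hph Wf) => //; lia.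
apply: (wp_le (b := 1 + (64 * (size r * node_count e (size r).-1) + 1 + c))); first by lia.
exec_block b_first; first by conjs; rewrite expn_gt0.
match goal with |- wp _ (_, MState ?R'' _ _) _ => set R2 := R'' end.
have I2 : inv R2 (y ++ u) r (size u) 1 ph by constructor; rewrite /R2; sx; irw I'.
have Ei : R2 ri = size (Nil nat) by [].
have {}H R3 T3 : inv R3 (y ++ u) r (size u) 1 ph -> tables_ok T3 ->
    T3 = foldl (act ph u) T1 (flatten [seq nodes e (rem b r) (b :: y) | b <- r]) ->
    wp c (l_up, MState R3 M T3) Q.
  by move=> I3 Tok3 ET3; apply: H => //; rewrite ET3.
move: {I I' P' Tok} T1 R2 H Tok1 I2 Ei.
have ur : uniq r by have := wf_uniq Wf; rewrite cat_uniq => /and3P[].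
(* Generalised to a loop in progress: [pre] holds the letters already tried, so the loop index is
   its length. *)
suff: forall s pre, r = pre ++ s -> forall T R,
    (forall R' T', inv R' (y ++ u) r (size u) 1 ph -> tables_ok T' ->
     T' = foldl (act ph u) T (flatten [seq nodes e (rem b r) (b :: y) | b <- s]) ->
     wp c (l_up, MState R' M T') Q) -> tables_ok T ->
    inv R (y ++ u) r (size u) 1 ph -> R ri = size pre ->
    wp (64 * (size s * node_count e (size r).-1) + 1 + c) (l_loop, MState R M T) Q.
  by move=> L T1 R1; apply: (L r [::]).
move=> {R T}; elim=> [|b s IHs] pre Er T R H Tok I Ei.
  apply: (wp_jumpeq (r1 := ri) (r2 := rN) (l := l_up)) => //=; rewrite Ei; irw I.
  by rewrite Er cats0 eqxx; apply: (wp_le (b := c)); [lia | apply: H].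
have br : b \in r by rewrite Er mem_cat mem_head orbT.
have Eb : index b r = size pre.
  rewrite Er index_cat /= eqxx addn0 ifN //.
  by move: ur; rewrite Er cat_uniq /= negb_or => /and3P[_ /andP[]].
have szr : size (rem b r) = (size r).-1 by rewrite size_rem.
have F0 := node_count_gt0 e (size r).-1.
set F := node_count e _ in F0 *.
apply: (wp_le (b := (15 + (64 * F - 36 + (2 + (17 +
    (64 * (size s * F) + 1 + c)))).+1).+1)); first by rewrite /=; lia.
apply: (wp_jumpeq (r1 := ri) (r2 := rN) (l := l_up)) => //=; rewrite Ei; irw I.
rewrite ifF; last by rewrite Er size_cat /=; lia.
apply: (push_ok I Wf br); first by rewrite Ei Eb.
move=> R1 I1.
apply: (wp_jumpeq (r1 := rf) (r2 := one) (l := l_enter)) => //=; irw I1 => /=.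
rewrite /F -szr; apply: (IH (b :: y)) => //; first by rewrite /=; lia.
  exact: wf_push.
move=> R2 T2 I2 Tok2 ET2.
apply: (wp_jumpeq (r1 := rf) (r2 := zero) (l := l_ascend)) => //=; irw I2 => /=.
apply: (wp_jumplt (r1 := rlev) (r2 := rd) (l := l_pop)) => //=; irw I2 => /=.
rewrite size_cat ltnS leq_addl.
apply: (pop_ok I2 Wf br) => R3 I3 E3.
rewrite szr; apply: (IHs (rcons pre b)) => //.
- by rewrite cat_rcons.
- by move=> R4 T4 I4 Tok4 ET4; apply: H => //; rewrite ET4 /= foldl_cat ET2.
- by rewrite E3 Eb size_rcons.
Qed.

Lemma key_inj j y y' :
  all (fun a => 0 < a < B) y -> all (fun a => 0 < a < B) y' ->
  key j y = key j y' -> y = y'.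
Proof.
move=> Dy Dy' /addIn E; apply: (code_inj Dy Dy'); apply/eqP.
by rewrite -(eqn_pmul2r (ltnW B_gt1)); apply/eqP.
Qed.

Lemma mem_W_digits y : y \in W -> all (fun a => 0 < a < B) y.
Proof.
rewrite mem_W => /and3P[_ _]; apply: sub_all => a /=; rewrite mem_iota.
by have := n_ltB; lia.
Qed.

(** All writes of the search at [u] go to level |u|, so lower levels survive. *)
Lemma foldl_act2_other u T s k : size u <= n -> k %% B != size u ->
  foldl (act 2 u) T s 2 k = T 2 k.
Proof.
move=> szu nk; elim/last_ind: s => // s x IH.
rewrite foldl_rcons /act updE /= updE ifN //.
by apply: contraNneq nk => ->; rewrite key_mod.
Qed.

(** Reads go to level |u| - 1 and writes to level |u|; hence the order of the visits is irrelevant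
    and the values read are those of the initial table. *)
Lemma foldl_act2 u T s y : u != [::] -> size u <= n -> {subset s <= W} -> y \in s ->
  foldl (act 2 u) T s 2 (key (size u) y) =
  Some (odflt 0 (T 2 (key (size u).-1 (rcons y (head 0 u)))) +
        odflt 0 (T 2 (key (size u).-1 y))).
Proof.
move=> u0 szu; have lev0 : 0 < size u by case: (u) u0.
have nk z : key (size u).-1 z %% B != size u by rewrite key_mod; lia.
elim/last_ind: s => // s x IH sub; rewrite mem_rcons inE foldl_rcons.
rewrite [act _ _ _ x]/act updE /= updE; case: (eqVneq y x) => [-> _|nyx /= ys].
  by rewrite eqxx !foldl_act2_other.
rewrite ifN; first by apply: IH => // z zs; apply: sub; rewrite mem_rcons inE zs orbT.
apply: contraNneq nyx => /key_inj ->; rewrite ?eqxx // mem_W_digits // sub //.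
  by rewrite mem_rcons inE ys orbT.
by rewrite mem_rcons mem_head.
Qed.

Definition level_ok (u r : seq nat) (T : nat -> nat -> option nat) : Prop :=
  forall y, uniq y -> {subset y <= r} -> size y <= K ->
  T 2 (key (size u) y) = Some (hits Ps u y).

Lemma size_Ps_K q : q \in Ps -> size q <= K.
Proof. by move=> qP; rewrite /K (leq_bigmax_seq (F := size)). Qed.

Lemma level_ok_push a u r T : wf (a :: u) r -> tables_ok T -> level_ok u (a :: r) T ->
  level_ok (a :: u) r (foldl (act 2 (a :: u)) T (nodes K r [::])).
Proof.
move=> Wf Tok G y uy suby szy.
have sz := wf_size Wf; rewrite /= in sz.
have ur : uniq r by have := wf_uniq Wf; rewrite cat_uniq => /and3P[].
have sub_r x : x \in r -> x \in iota 1 n.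
  by move=> xr; case: (Wf) => /perm_mem <- _; rewrite mem_cat xr orbT.
have nar : a \notin r.
  by have := wf_uniq Wf; rewrite /= mem_cat negb_or => /andP[/andP[]].
have ay : a \notin y by apply: contra nar; exact: suby.
have an : a \in iota 1 n by case: (Wf) => /perm_mem <- _; rewrite mem_head.
rewrite foldl_act2 //=; first 1 last.
- by lia.
- move=> x; rewrite mem_nodes0 // mem_W => /and3P[-> -> /allP H] /=.
  by apply/allP => z /H; exact: sub_r.
- by rewrite mem_nodes0 // szy uy /=; apply/allP.
have uya : uniq (rcons y a) by rewrite rcons_uniq ay.
rewrite addnC (G y) // => [|x /suby xr]; last by rewrite inE xr orbT.
congr (Some (_ + _)); case: (ltnP (size y) K) => leK.
  rewrite G ?size_rcons // => x; rewrite mem_rcons !inE => /orP[->//|/suby ->].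
  by rewrite orbT.
(* If |y| = K, then y a is too long ever to have been stored; the failed lookup yields 0, which is
   the right value. *)
rewrite (hits_eq0 (K := K)) ?size_rcons //; last exact: size_Ps_K.
case E: (T 2 _) => [v|] //; have := tables_keys Tok E.
case/allpairsP => -[j x]; rewrite mem_iota add0n ltnS /= => -[jn xW Ex].
have Ej : j = size u.
  by have := congr1 (modn^~ B) Ex; rewrite /= !key_mod //; lia.
rewrite Ej in Ex; have Ex' : rcons y a = x.
  apply: key_inj Ex; last exact: mem_W_digits.
  apply/allP => b; rewrite mem_rcons inE => bay.
  have: b \in iota 1 n by case/orP: bay => [/eqP->//|/suby/sub_r].
  by rewrite mem_iota; have := n_ltB; lia.
by move: xW; rewrite -Ex' mem_W size_rcons ltnNge leK.
Qed.

Lemma fact_leq_exp m : m <= n -> m`! <= B ^ m.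
Proof.
elim: m => // m IH lem; rewrite factS expnS leq_mul ?IH // ltnW //.
exact: leq_ltn_trans lem n_ltB.
Qed.

Lemma node_count_lt : node_count K n < 3 * B ^ n.
Proof.
by apply: leq_trans (node_count_fact K n) _; rewrite leq_mul2l fact_leq_exp.
Qed.

Lemma Ps_W q : q \in Ps -> q \in W.
Proof.
move=> qP; rewrite mem_W size_Ps_K //; have [pq szq] := Ps_perm qP.
rewrite (perm_uniq pq) iota_uniq /=; apply/allP => a; rewrite (perm_mem pq) /= !mem_iota.
by case/andP=> -> /leq_trans -> //; rewrite leq_add2l.
Qed.

Hypothesis Ps_uniq : uniq Ps.

(** The patterns are distinct words of [W]. *)
Lemma size_Ps : size Ps <= node_count K n.
Proof.
rewrite -[n](size_iota 1) -(size_nodes K (iota 1 n) [::]).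
by apply: uniq_leq_size => // q; exact: Ps_W.
Qed.

Lemma nmem_lt_w : nmem < 2 ^ w.
Proof.
have := size_Ps; have := node_count_lt.
have B1 := B_gt1; have Bn : 0 < B ^ n by rewrite expn_gt0 ltnW.
(* The memory has at most 2 [node_count K n] + 3 <= 9 B^n cells, and 9 < 16 <= B^4. *)
have : 16 <= B ^ 4 by rewrite (leq_exp2r 2 B (e := 4)).
have : B ^ (n + 4) < 2 ^ w by apply: expB_lt_w; lia.
by rewrite expnD /nmem /base; nia.
Qed.

Lemma leaf_ok a u R M T c Q :
  inv R (a :: u) [::] (size u).+1 1 2 -> wf (a :: u) [::] -> level_ok (a :: u) [::] T ->
  (forall x, base <= x -> M x + 1 < 2 ^ w) ->
  (forall R' M', inv R' (a :: u) [::] (size u).+1 0 2 ->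
     (forall x, M' x = M x + (base + hits Ps (a :: u) [::] == x)) ->
     wp c (l_ascend, MState R' M' T) Q) ->
  wp (13 + c) (l_up, MState R M T) Q.
Proof.
move=> I Wf G HM H; have := wf_size Wf; rewrite /= addn0 => sz.
set h := hits Ps (a :: u) [::].
(* The key of the empty word at level j is j itself, so the level register serves as the key. *)
have Eh : T 2 (size u).+1 = Some h.
  by have := G [::] isT (fun x xn => xn) (leq0n _); rewrite /key mul0n add0n.
have leh : h <= node_count K n.
  have := hits_leq (K := K) (a :: u) [::] size_Ps_K; rewrite subn0 -sz; exact.
have L1 : base + h < nmem by rewrite ltn_add2l ltnS.
have L2 := ltn_trans L1 nmem_lt_w.
apply: (wp_jumpeq (r1 := rf) (r2 := zero) (l := l_ascend)) => //=; irw I => /=.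
apply: (wp_jumplt (r1 := rlev) (r2 := rd) (l := l_pop)) => //=; irw I; rewrite ltnn.
apply: (wp_jumpeq (r1 := rph) (r2 := zero) (l := l_restart)) => //=; irw I => /=.
apply: (wp_le (b := 3 + (1 + (5 + (1 + c))))); first by lia.
exec_block b_outer.
  by conjs; rewrite ?expn_gt0 //; apply: (@small_lt_w 2); lia.
match goal with |- wp _ (_, MState ?R' _ _) _ => set R1 := R' end.
have I1 : inv R1 (a :: u) [::] (size u).+1 0 2.
  by constructor; rewrite /R1; sx; irw I.
apply: (wp_jumplt (r1 := zero) (r2 := rN) (l := l_loop)) => //=; irw I1; rewrite ltnn.
exec_block b_leaf.
  irw I1; rewrite Eh; conjs.
  by apply: HM; exact: leq_addr.
apply: (wp_jump (l := l_ascend)) => //.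
apply: H; first by constructor; sx; irw I1.
move=> x; cbv beta; irw I1; rewrite Eh [odflt _ _]/=.
match goal with |- (if ?e then _ else _) = _ => change e with (x == base + h) end.
case: eqP => [->|/eqP ne]; first by rewrite eqxx.
by rewrite eq_sym (negbTE ne) addn0.
Qed.

Lemma level_ok_sub u r r' T : {subset r' <= r} -> level_ok u r T -> level_ok u r' T.
Proof. by move=> sub G y uy sy szy; apply: G => // x /sy /sub. Qed.

(** * The outer search *)

Definition leaf_count (m : nat) (r u : seq nat) (x : nat) : nat :=
  count (fun tau => base + hits Ps tau [::] == x) (leaves m r u).

(** With F nodes in the inner tree, a node of the outer one costs at most 64 F - 36 for the inner
    search, 13 around it and 39 for its edge, so at most 80 F; the edge of the root is left out.
    Preserving the levels up to |u| lets siblings read the same parent entries. *)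
Definition outer_spec (m : nat) : Prop := forall a u r R M T c Q,
  size r = m -> inv R (a :: u) r (size u).+1 1 2 -> wf (a :: u) r ->
  tables_ok T -> level_ok u (a :: r) T ->
  (forall x, base <= x -> M x + m`! < 2 ^ w) ->
  (forall R' M' T', inv R' (a :: u) r (size u).+1 0 2 -> tables_ok T' ->
     (forall k, k %% B <= size u -> T' 2 k = T 2 k) ->
     (forall x, M' x = M x + leaf_count m r (a :: u) x) ->
     wp c (l_ascend, MState R' M' T') Q) ->
  wp (80 * visit_count K m - 39 + c) (l_enter, MState R M T) Q.

Lemma visit_count_gt0 e m : 0 < visit_count e m.
Proof. by case: m => [|m] /=; rewrite addn_gt0 node_count_gt0. Qed.

Lemma children_ok m u r R M T c Q :
  outer_spec m -> size r = m.+1 -> inv R u r (size u) 0 2 -> wf u r ->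
  tables_ok T -> level_ok u r T -> R ri = 0 ->
  (forall x, base <= x -> M x + m.+1`! < 2 ^ w) ->
  (forall R' M' T', inv R' u r (size u) 0 2 -> tables_ok T' ->
     (forall k, k %% B <= size u -> T' 2 k = T 2 k) ->
     (forall x, M' x = M x + leaf_count m.+1 r u x) ->
     wp c (l_ascend, MState R' M' T') Q) ->
  wp (80 * (m.+1 * visit_count K m) + 2 + c) (l_loop, MState R M T) Q.
Proof.
move=> IH szr I Wf Tok G Ei HM H.
have ur : uniq r by have := wf_uniq Wf; rewrite cat_uniq => /and3P[].
have g0 := visit_count_gt0 K m.
(* Again a loop in progress, over the letters [s] still to be tried. Each of them can raise a
   counter by at most m!, and the bound on memory reserves that much. *)
suff: forall s pre, r = pre ++ s -> forall R M T,
    inv R u r (size u) 0 2 -> tables_ok T -> level_ok u r T -> R ri = size pre ->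
    (forall x, base <= x -> M x + size s * m`! < 2 ^ w) ->
    (forall R' M' T', inv R' u r (size u) 0 2 -> tables_ok T' ->
     (forall k, k %% B <= size u -> T' 2 k = T 2 k) ->
     (forall x, M' x = M x + \sum_(b <- s) leaf_count m (rem b r) (b :: u) x) ->
     wp c (l_ascend, MState R' M' T') Q) ->
    wp (80 * (size s * visit_count K m) + 2 + c) (l_loop, MState R M T) Q.
  move=> L; rewrite -szr; apply: (L r [::]) => //; first by rewrite szr -factS.
  move=> R' M' T' I' Tok' ET' EM'; apply: H => // x; rewrite EM'; congr (_ + _).
  rewrite /leaf_count /= count_flatten -map_comp sumnE big_map.
  by apply: eq_bigr.
move=> {R M T I Tok G Ei HM H}; elim=> [|b s IHs] pre Er R M T I Tok G Ei HM H.
  apply: (wp_jumpeq (r1 := ri) (r2 := rN) (l := l_up)) => //=; rewrite Ei; irw I.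
  rewrite Er cats0 eqxx.
  apply: (wp_jumpeq (r1 := rf) (r2 := zero) (l := l_ascend)) => //=; irw I => /=.
  by apply: H => // x; rewrite big_nil addn0.
have br : b \in r by rewrite Er mem_cat mem_head orbT.
have Eb : index b r = size pre.
  rewrite Er index_cat /= eqxx addn0 ifN //.
  by move: ur; rewrite Er cat_uniq /= negb_or => /and3P[_ /andP[]].
have szr' : size (rem b r) = m by rewrite size_rem // szr.
set g := visit_count K m in g0 *.
have Wf' := wf_push Wf br.
have szn := wf_size Wf'.
apply: (wp_le (b := (15 + (1 + (2 + (80 * g - 39 + (2 + (17 +
    (80 * (size s * g) + 2 + c)))).+1))).+1)); first by rewrite /=; lia.
apply: (wp_jumpeq (r1 := ri) (r2 := rN) (l := l_up)) => //=; rewrite Ei; irw I.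
rewrite ifF; last by rewrite Er size_cat /=; lia.
apply: (push_ok I Wf br); first by rewrite Ei Eb.
move=> R1 I1.
apply: (wp_jumpeq (r1 := rf) (r2 := one) (l := l_enter)) => //=; irw I1 => /=.
exec_block b_deeper.
  irw I1; conjs; first by apply: small_lt_w; rewrite /= in szn; lia.
  by apply: (@small_lt_w 1); lia.
apply: (wp_jump (l := l_enter)) => //.
match goal with |- wp _ (_, MState ?R' _ _) _ => set R2 := R' end.
have I2 : inv R2 (b :: u) (rem b r) (size u).+1 1 2.
  by constructor; rewrite /R2; sx; irw I1 => //=; rewrite addn1.
have sub_b : {subset b :: rem b r <= r}.
  by move=> x; rewrite inE => /orP[/eqP->//|]; exact: mem_rem.
apply: (IH _ _ _ _ _ _ _ _ szr' I2 Wf' Tok (level_ok_sub sub_b G)).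
  by move=> x bx; have := HM x bx; rewrite /= mulSn; lia.
move=> R3 M3 T3 I3 Tok3 ET3 EM3.
apply: (wp_jumpeq (r1 := rlev) (r2 := zero) (l := l_length)) => //=; irw I3 => /=.
apply: (wp_le (b := 1 + (17 + (80 * (size s * g) + 2 + c)))); first by lia.
exec_block b_shallower; first by irw I3.
match goal with |- wp _ (_, MState ?R' _ _) _ => set R4 := R' end.
have I4 : inv R4 (b :: u) (rem b r) (size u) 0 2.
  by constructor; rewrite /R4; sx; irw I3 => //=; rewrite subn1.
apply: (pop_ok I4 Wf br) => R5 I5 E5.
apply: (IHs (rcons pre b)) => //.
- by rewrite cat_rcons.
- move=> y uy suby szy; rewrite ET3; first exact: G.
  by rewrite key_mod //; rewrite /= in szn; lia.
- by rewrite E5 Eb size_rcons.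
- move=> x bx; have := HM x bx; rewrite EM3 /= mulSn.
  have : leaf_count m (rem b r) (b :: u) x <= m`!.
    by rewrite -szr' -(size_leaves _ (b :: u)) count_size.
  lia.
move=> R6 M6 T6 I6 Tok6 ET6 EM6; apply: H => //.
  by move=> k lek; rewrite ET6 // ET3.
by move=> x; rewrite EM6 EM3 big_cons addnA.
Qed.

Lemma outer_ok m : outer_spec m.
Proof.
elim: m => [|m IH] a u r R M T c Q szr I Wf Tok G HM H.
  case: r szr I Wf G H => // _ I Wf G H.
  apply: (wp_le (b := 64 * node_count K 0 - 36 + (13 + c))).
    by rewrite /=; have := node_count_gt0 K 0; lia.
  apply: (inner_ok (ph := 2) (u := a :: u) (y := [::]) _ I Wf _ Tok) => //.
    by rewrite /= addn0.
  move=> R1 T1 I1 Tok1 ET1.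
  have G1 : level_ok (a :: u) [::] T1 by rewrite ET1; apply: level_ok_push.
  apply: (leaf_ok I1 Wf G1) => // R2 M2 I2 EM2; apply: H => //.
    move=> k lek; rewrite ET1 foldl_act2_other //=; last by lia.
    by have := wf_size Wf; rewrite /=; lia.
  by move=> x; rewrite EM2 /leaf_count /= addn0.
have szn := wf_size Wf.
apply: (wp_le (b := 64 * node_count K (size r) - 36 + ((3 + (1 +
    (80 * (m.+1 * visit_count K m) + 2 + c)))).+3)).
  by rewrite szr /=; have := node_count_gt0 K m.+1; lia.
apply: (inner_ok (ph := 2) (u := a :: u) (y := [::]) _ I Wf _ Tok) => //.
  by rewrite /= addn0.
move=> R1 T1 I1 Tok1 ET1.
have G1 : level_ok (a :: u) r T1 by rewrite ET1; apply: level_ok_push.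
apply: (wp_jumpeq (r1 := rf) (r2 := zero) (l := l_ascend)) => //=; irw I1 => /=.
apply: (wp_jumplt (r1 := rlev) (r2 := rd) (l := l_pop)) => //=; irw I1; rewrite ltnn.
apply: (wp_jumpeq (r1 := rph) (r2 := zero) (l := l_restart)) => //=; irw I1 => /=.
exec_block b_outer.
  by conjs; rewrite ?expn_gt0 //; apply: (@small_lt_w 2); lia.
match goal with |- wp _ (_, MState ?R' _ _) _ => set R2 := R' end.
have I2 : inv R2 (a :: u) r (size u).+1 0 2.
  by constructor; rewrite /R2; sx; irw I1.
apply: (wp_jumplt (r1 := zero) (r2 := rN) (l := l_loop)) => //=; irw I2; rewrite szr.
apply: (children_ok IH szr I2 Wf Tok1 G1) => // R3 M3 T3 I3 Tok3 ET3 EM3.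
apply: H => // k lek; rewrite ET3 /=; last by lia.
rewrite ET1 foldl_act2_other //=; last by lia.
by rewrite /= in szn; lia.
Qed.

(** * Phases 0 and 1: level 0 of the table *)

Lemma code_mem_Ps y : y \in W -> (code B y \in [seq code B q | q <- Ps]) = (y \in Ps).
Proof.
move=> yW; apply/mapP/idP => [[q qP E]|yP]; last by exists y.
by rewrite (code_inj (mem_W_digits yW) (pattern_digits qP) E).
Qed.

(** No Lehmer code is computed from a pattern directly: the search passes through all words of [W]
    with their Lehmer codes at hand and recognises the patterns by table 0. *)
Lemma foldl_act0 T s k : {subset s <= W} ->
  (forall k', T 0 k' = if k' \in [seq code B q | q <- Ps] then Some 1 else None) ->
  T 1 k = None ->
  odflt 0 (foldl (act 0 [::]) T s 1 k) =
  has (fun y => (y \in Ps) && (code B (lehmer y) == k)) s.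
Proof.
move=> sub T0 T1; have E0 s' k' : foldl (act 0 [::]) T s' 0 k' = T 0 k'.
  by elim/last_ind: s' => // s' x IH; rewrite foldl_rcons /act; case: eqP.
elim/last_ind: s sub => [|s x IH] sub; first by rewrite /= T1.
rewrite has_rcons foldl_rcons /act cats0 E0 T0 code_mem_Ps; last first.
  by apply: sub; rewrite mem_rcons mem_head.
have {}IH : odflt 0 (foldl (act 0 [::]) T s 1 k) =
    has (fun y => (y \in Ps) && (code B (lehmer y) == k)) s.
  by apply: IH => y ys; apply: sub; rewrite mem_rcons inE ys orbT.
case: (x \in Ps) => //=; rewrite updE /= updE (eq_sym _ k).
by case: eqP.
Qed.

Lemma foldl_act1 T s y : {subset s <= W} -> y \in s ->
  foldl (act 1 [::]) T s 2 (key 0 y) = Some (odflt 0 (T 1 (code B (lehmer y)))).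
Proof.
have E1 s' k' : foldl (act 1 [::]) T s' 1 k' = T 1 k'.
  by elim/last_ind: s' => // s' x IH; rewrite foldl_rcons /act updE.
elim/last_ind: s => // s x IH sub; rewrite mem_rcons inE foldl_rcons.
rewrite [act _ _ _ x]/act cats0 updE /= updE E1.
have -> : code B x * B = key 0 x by rewrite /key addn0.
case: (eqVneq y x) => [->|nyx /= ys]; first by rewrite eqxx.
rewrite ifN; first by apply: IH => // z zs; apply: sub; rewrite mem_rcons inE zs orbT.
apply: contraNneq nyx => /key_inj ->; rewrite ?eqxx // mem_W_digits // sub //.
  by rewrite mem_rcons inE ys orbT.
by rewrite mem_rcons mem_head.
Qed.

(** At level 0 [hits] asks for a pattern order-isomorphic to y, that is, one with the same Lehmer
    code. Phase 0 meets every pattern, since all of them lie in [W]. *)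
Lemma level_ok_base T :
  (forall k', T 0 k' = if k' \in [seq code B q | q <- Ps] then Some 1 else None) ->
  (forall k, T 1 k = None) ->
  level_ok [::] (iota 1 n) (foldl (act 1 [::]) (foldl (act 0 [::]) T W) W).
Proof.
move=> T0 T1 y uy suby szy.
have yW : y \in W by rewrite mem_W szy uy; apply/allP.
rewrite foldl_act1 // foldl_act0 //=; congr (Some (nat_of_bool _)).
have dl x : x \in W -> all (fun a => 0 < a < B) (lehmer x).
  rewrite mem_W => /and3P[_ ux /allP sx]; apply: lehmer_digits => //.
  by apply/allP => a /sx; rewrite /= mem_iota; lia.
have oi q : q \in Ps -> order_isomorphic y q = (lehmer y == lehmer q).
  move=> qP; rewrite order_isomorphic_lehmer //.
  by have := Ps_W qP; rewrite mem_W => /and3P[].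
apply/hasP/hasP => [[q qW /andP[qP /eqP E]]|[q qP]].
  by exists q => //; rewrite oi //; apply/eqP; apply: (code_inj (dl _ yW) (dl _ qW)).
rewrite oi // => /eqP E; exists q; first exact: Ps_W.
by rewrite qP E /=.
Qed.

(** * Initialisation of the registers *)

Record init (R : nat -> nat) (j i mx rm : nat) : Prop := Init {
  init_zero : R zero = 0;
  init_one : R one = 1;
  init_n : R rn = n;
  init_base : R rbase = base;
  init_B : R rB = 2 ^ j;
  init_bw : R rbw = j;
  init_i : R ri = i;
  init_max : R rmax = mx;
  init_rem : R rrem = rm;
  init_z : R rz = 0;
  init_lc : R rlc = 0;
  init_d : R rd = 0;
  init_lev : R rlev = 0;
  init_ph : R rph = 0 }.

Ltac nrw I := rewrite ?(init_zero I) ?(init_one I) ?(init_n I) ?(init_base I)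
  ?(init_B I) ?(init_bw I) ?(init_i I) ?(init_max I) ?(init_rem I) ?(init_z I)
  ?(init_lc I) ?(init_d I) ?(init_lev I) ?(init_ph I).

(** As [bw] is one more than the integer logarithm of n, 2^j <= n holds exactly for j < bw, and
    doubling stops at j = bw. *)
Lemma width_ok R M T j c Q : j <= bw -> init R j 2 0 0 ->
  (forall R', init R' bw 2 0 0 -> wp c (l_patterns, MState R' M T) Q) ->
  wp (4 * (bw - j) + 1 + c) (l_width, MState R M T) Q.
Proof.
move=> lej I H; move Em: (bw - j) => m.
elim: m j R lej I Em => [|m IH] j R lej I Em.
  have Ej : j = bw by lia.
  apply: (wp_jumplt (r1 := rn) (r2 := rB) (l := l_patterns)) => //=; nrw I.
  by rewrite Ej n_ltB; apply: H; rewrite -Ej.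
apply: (wp_le (b := (2 + (4 * m + 1 + c).+1).+1)); first by lia.
apply: (wp_jumplt (r1 := rn) (r2 := rB) (l := l_patterns)) => //=; nrw I.
have ltj : j < bw by lia.
have le2 : 2 ^ j <= n.
  apply: leq_trans (trunc_logP (ltnSn 1) n_gt0).
  by rewrite leq_exp2l // -ltnS.
rewrite ltnNge le2 /=.
have E2 : 2 ^ j + 2 ^ j = 2 ^ j.+1 by rewrite expnS mul2n addnn.
exec_block b_double.
  nrw I; rewrite E2; conjs.
    apply: (@lt_w _ 1); first by lia.
    by rewrite expn1 leq_exp2l.
  by apply: (@lt_w _ 1); [lia | rewrite expn1; have := bw_ltB; lia].
apply: (wp_jump (l := l_width)) => //.
apply: (IH j.+1) => //; last by lia.
by constructor; sx; nrw I; rewrite ?E2 ?addn1.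
Qed.

Lemma patterns_ok R M T c Q : init R bw 2 0 0 ->
  (forall i, i < size Ps -> M i.+2 = code B (nth [::] Ps i)) ->
  (forall h k, T h k = None) ->
  (forall R' T', init R' bw base maxc 0 ->
     (forall k, T' 0 k = if k \in [seq code B q | q <- Ps] then Some 1 else None) ->
     (forall h k, 0 < h -> T' h k = None) ->
     wp c (l_letters, MState R' M T') Q) ->
  wp (7 * size Ps + 1 + c) (l_patterns, MState R M T) Q.
Proof.
move=> I HM HT H.
suff: forall s pre, Ps = pre ++ s -> forall R T,
    init R bw (size pre).+2 (\max_(q <- pre) code B q) 0 ->
    (forall k, T 0 k = if k \in [seq code B q | q <- pre] then Some 1 else None) ->
    (forall h k, 0 < h -> T h k = None) ->
    wp (7 * size s + 1 + c) (l_patterns, MState R M T) Q.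
  by move=> L; apply: (L Ps [::]) => //; rewrite big_nil.
move=> {R T I HT}; elim=> [|q s IH] pre EP R T I T0 Tp.
  apply: (wp_jumpeq (r1 := ri) (r2 := rbase) (l := l_letters)) => //=; nrw I.
  rewrite cats0 in EP; rewrite -EP in I T0 *; rewrite eqxx.
  exact: H.
have szP : size pre < size Ps by rewrite EP size_cat /=; lia.
have qP : q \in Ps by rewrite EP mem_cat mem_head orbT.
have HMq : M (size pre).+2 = code B q.
  by rewrite HM // EP nth_cat ltnn subnn.
have [_ szq] := Ps_perm qP.
have Lq : code B q < 2 ^ w.
  by apply: (@code_lt_w _ n); [exact/digits_lt/pattern_digits | | lia].
have Lb : base < 2 ^ w by apply: leq_ltn_trans (leq_addr _ _) nmem_lt_w.
apply: (wp_le (b := (2 + (1 + (1 + (7 * size s + 1 + c).+1)).+1).+1)).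
  by rewrite /=; lia.
apply: (wp_jumpeq (r1 := ri) (r2 := rbase) (l := l_letters)) => //=; nrw I.
rewrite ifF; last by rewrite /base; lia.
exec_block b_pattern.
  by nrw I; rewrite HMq; conjs; apply: map_f.
match goal with |- wp _ (_, MState ?R' _ ?T') _ => set R1 := R'; set T1 := T' end.
have I1 : init R1 bw (size pre).+2 (\max_(q <- pre) code B q) 0.
  by constructor; rewrite /R1; sx; nrw I.
have E1 : R1 rv = code B q by rewrite /R1; sx; nrw I; rewrite HMq.
have T10 k : T1 0 k =
    if k \in [seq code B q | q <- rcons pre q] then Some 1 else None.
  rewrite map_rcons mem_rcons inE /T1; sx; nrw I; rewrite HMq.
  match goal with |- (if ?e then _ else _) = _ => change e with (k == code B q) end.
  by case: (k =P _) => // _; rewrite T0.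
have T1p h k : 0 < h -> T1 h k = None.
  by case: h => // h; exact: Tp.
have Emax : \max_(q <- rcons pre q) code B q =
    maxn (\max_(q <- pre) code B q) (code B q).
  by rewrite -cats1 big_cat /= big_seq1.
have EPs : Ps = rcons pre q ++ s by rewrite cat_rcons.
have next R2 : init R2 bw (size pre).+2 (\max_(q <- rcons pre q) code B q) 0 ->
    wp (1 + (7 * size s + 1 + c).+1) (l_next, MState R2 M T1) Q.
  move=> I2; exec_block b_next.
    by nrw I2; conjs; rewrite addn1; apply: leq_ltn_trans Lb; rewrite /base !ltnS.
  apply: (wp_jump (l := l_patterns)) => //; apply: (IH _ EPs) => //.
  by constructor; sx; nrw I2; rewrite ?size_rcons ?addn1.
apply: (wp_jumplt (r1 := rv) (r2 := rmax) (l := l_next)) => //=; nrw I1; rewrite E1.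
case: ltnP => [lt|le].
  apply: (wp_le (b := 1 + (7 * size s + 1 + c).+1)); first by lia.
  by apply: next; rewrite Emax (maxn_idPl (ltnW lt)).
exec_block b_max; first by nrw I1; rewrite E1 addn0.
apply: next; rewrite Emax (maxn_idPr le).
by constructor; sx; nrw I1; rewrite ?E1 ?addn0.
Qed.

(** The letters are prepended from n down to 1, which makes the list increasing. *)
Lemma letters_ok R M T c Q : init R bw base maxc 0 ->
  (forall R', inv R' [::] (iota 1 n) 0 1 0 -> wp c (l_enter, MState R' M T) Q) ->
  wp (5 * n + 4 + c) (l_letters, MState R M T) Q.
Proof.
move=> I H.
apply: (wp_le (b := 1 + (5 * n + 1 + (2 + c)))); first by lia.
exec_block b_top.
  by nrw I; rewrite addn0; conjs; apply: small_lt_w; lia.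
match goal with |- wp _ (_, MState ?R' _ _) _ => set R1 := R' end.
have I1 : init R1 bw base maxc (code B (iota n.+1 (n - n))).
  by rewrite subnn; constructor; rewrite /R1; sx; nrw I.
have E1 : R1 rb = n by rewrite /R1; sx; nrw I; rewrite addn0.
suff: forall j R, j <= n -> init R bw base maxc (code B (iota j.+1 (n - j))) ->
    R rb = j -> wp (5 * j + 1 + (2 + c)) (l_letter, MState R M T) Q.
  by move=> L; apply: L.
move=> {R R1 I I1 E1}; elim=> [|j IH] R lej I Ej.
  apply: (wp_jumpeq (r1 := rb) (r2 := zero) (l := l_start)) => //=; nrw I; rewrite Ej eqxx.
  exec_block b_start.
    nrw I; rewrite addn0; conjs; first by apply: small_lt_w; lia.
    by apply: (@small_lt_w 1); lia.
  apply: H; constructor; sx; nrw I => //=; first by rewrite subn0.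
  by rewrite size_iota addn0.
apply: (wp_le (b := (3 + (5 * j + 1 + (2 + c)).+1).+1)); first by lia.
apply: (wp_jumpeq (r1 := rb) (r2 := zero) (l := l_start)) => //=; nrw I; rewrite Ej /=.
have E : code B (iota j.+2 (n - j.+1)) * B + j.+1 = code B (iota j.+1 (n - j)).
  by rewrite (_ : n - j = (n - j.+1).+1) /= ?[j.+1 + _]addnC //; lia.
have L : code B (iota j.+1 (n - j)) < 2 ^ w.
  apply: (@code_lt_w _ n); [|by rewrite size_iota; lia|by lia].
  by apply/allP => a; rewrite mem_iota; have := n_ltB; lia.
exec_block b_letter.
  by nrw I; rewrite Ej -/B E; conjs; lia.
apply: (wp_jump (l := l_letter)) => //.
apply: IH; first by lia.
  by constructor; sx; nrw I; rewrite ?Ej -?/B ?E.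
by sx; rewrite Ej (init_one I) subn1.
Qed.

(** * The complete run *)

Lemma program_ok M :
  M 0 = n -> M 1 = size Ps ->
  (forall i, i < size Ps -> M i.+2 = code B (nth [::] Ps i)) ->
  (forall x, base <= x -> M x = 0) ->
  wp (80 * visit_count K n + 135 * node_count K n + 9 * n + 20)
    (0, MState (fun _ => 0) M (fun _ _ => None))
    (fun c => [/\ c.1 = l_halt, mreg c.2 rbase = base, mreg c.2 rlen = B ^ n.+2
      & forall m, mmem c.2 (base + m) =
          count (fun tau => hits Ps tau [::] == m) (leaves n (iota 1 n) [::])]).
Proof.
move=> M0 M1 HM Mout.
have Wf0 : wf [::] (iota 1 n) by split; [exact: perm_refl | exact: iota_ltn_sorted].
set Qf := (fun c : nat * mstate => _).
have szPs := size_Ps.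
have lebw : bw <= n.
  have : 2 ^ (trunc_log 2 n) <= n by exact: trunc_logP.
  by rewrite /bw /block_width; apply: leq_trans; exact: ltn_expl.
set F := node_count K n in szPs *.
have F0 : 0 < F by exact: node_count_gt0.
set G := n * visit_count K n.-1.
have EG : visit_count K n = F + G.
  by rewrite /F /G; case: (n) n_gt0.
(* The coefficient 135 is 64 for each of phases 0 and 1 plus 7 for reading a pattern; 9 n covers 4
   steps per bit of [bw] <= n and 5 per letter. *)
apply: (wp_le (b := 6 + (4 * (bw - 0) + 1 + (7 * size Ps + 1 + (5 * n + 4 +
    (64 * F - 36 + (1 + (64 * F - 36 + (3 + (80 * G + 2 + (4 + 0).+1).+1).+3).+1).+3)))))).
  by lia.
exec_block b_init.
  rewrite M1; conjs; try by apply: small_lt_w; lia.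
  by rewrite addn2; apply: leq_ltn_trans (leq_addr _ _) nmem_lt_w.
apply: width_ok => //.
  by constructor; sx; rewrite ?M0 ?M1 ?addn2.
move=> R1 I1; apply: (patterns_ok I1 HM) => // R2 T2 I2 T20 T2p.
apply: (letters_ok I2) => R3 I3.
have Tok2 : tables_ok T2 by split=> k v; rewrite T2p.
have EF : F = node_count K (size (iota 1 n)) by rewrite size_iota.
rewrite EF.
apply: (inner_ok (ph := 0) (u := [::]) (y := [::]) _ I3 Wf0 _ Tok2) => //.
  by rewrite /= addn0.
move=> R4 T4 I4 Tok4 ET4.
apply: (wp_jumpeq (r1 := rf) (r2 := zero) (l := l_ascend)) => //=; irw I4 => /=.
apply: (wp_jumplt (r1 := rlev) (r2 := rd) (l := l_pop)) => //=; irw I4 => /=.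
apply: (wp_jumpeq (r1 := rph) (r2 := zero) (l := l_restart)) => //=; irw I4 => /=.
exec_block b_phase1.
  by conjs; apply: (@small_lt_w 1).
apply: (wp_jump (l := l_enter)) => //.
match goal with |- wp _ (_, MState ?R' _ _) _ => set R5 := R' end.
have I5 : inv R5 [::] (iota 1 n) 0 1 1 by constructor; rewrite /R5; sx; irw I4.
apply: (inner_ok (ph := 1) (u := [::]) (y := [::]) _ I5 Wf0 _ Tok4) => //.
  by rewrite /= addn0.
move=> R6 T6 I6 Tok6 ET6.
apply: (wp_jumpeq (r1 := rf) (r2 := zero) (l := l_ascend)) => //=; irw I6 => /=.
apply: (wp_jumplt (r1 := rlev) (r2 := rd) (l := l_pop)) => //=; irw I6 => /=.
apply: (wp_jumpeq (r1 := rph) (r2 := zero) (l := l_restart)) => //=; irw I6 => /=.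
exec_block b_outer.
  by conjs; rewrite ?expn_gt0 //; apply: (@small_lt_w 2).
match goal with |- wp _ (_, MState ?R' _ _) _ => set R7 := R' end.
have I7 : inv R7 [::] (iota 1 n) 0 0 2 by constructor; rewrite /R7; sx; irw I6.
apply: (wp_jumplt (r1 := zero) (r2 := rN) (l := l_loop)) => //=; irw I7.
rewrite size_iota n_gt0 /G.
have [m Em] : exists m, n = m.+1 by exists n.-1; rewrite prednK.
have szm : size (iota 1 n) = m.+1 by rewrite size_iota.
have G6 : level_ok [::] (iota 1 n) T6.
  by rewrite ET6 ET4; apply: level_ok_base => // k; rewrite T2p.
have -> : n * visit_count K n.-1 = m.+1 * visit_count K m by rewrite Em.
apply: (children_ok (@outer_ok m) szm I7 Wf0 Tok6 G6) => //.
  (* A counter never exceeds n! <= B^n. *)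
  move=> x bx; rewrite Mout // add0n -Em; apply: (@lt_w _ n); first by lia.
  exact: fact_leq_exp.
move=> R8 M8 T8 I8 Tok8 _ EM8.
apply: (wp_jumpeq (r1 := rlev) (r2 := zero) (l := l_length)) => //=; irw I8 => /=.
have Elen : 2 ^ ((n + 1 + 1) * bw) = B ^ n.+2 by rewrite pow_bw !addn1.
exec_block b_length.
  irw I8; rewrite mul1n Elen; conjs.
  - by apply: (@small_lt_w); lia.
  - apply: (@lt_w _ 2); first by lia.
    by have := n_ltB; have := B_gt1; rewrite expnS expn1; nia.
  - apply: (@lt_w _ 3); first by lia.
    have := n_ltB; have := bw_ltB; have := B_gt1 => B1 b1 n1.
    have : n + 1 + 1 <= B ^ 2 by rewrite expnS expn1; nia.
    by move=> le2; rewrite expnSr leq_mul // ltnW.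
  - by apply: expB_lt_w; lia.
apply: wp_done; split=> //.
- by sx; irw I8.
- by sx; irw I8; rewrite mul1n Elen.
- move=> k; rewrite [mmem _]/=  EM8 Mout ?leq_addr // add0n /leaf_count -Em.
  by apply: eq_count => tau; rewrite /= eqn_add2l.
Qed.

End Program.

(** * Input, output and the bounds *)

Lemma encode_code n s : encode n s = N.of_nat (code (2 ^ block_width n) s).
Proof.
elim: s => // a s IH.
transitivity (N.of_nat a + N.shiftl (encode n s) (N.of_nat (block_width n)))%num => //.
by rewrite IH N.shiftl_mul_pow2 pow2_of_nat; cbn [code]; lia.
Qed.

Lemma nth_map_of_nat l a : nth N0 (map N.of_nat l) a = N.of_nat (nth 0 l a).
Proof.
case: (ltnP a (size l)) => lta; first by rewrite (nth_map 0).
by rewrite !nth_default // size_map.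
Qed.

Lemma leq_fact m : m <= m`!.
Proof. by case: m => // m; rewrite factS leq_pmulr // fact_gt0. Qed.

Lemma ltn_exp_add2 b m : 1 < b -> 3 * b ^ m < b ^ m.+2.
Proof.
move=> b1; rewrite !expnS mulnA; apply: leq_trans (leq_mul (leq_mul b1 b1) (leqnn _)).
by rewrite ltn_mul2r expn_gt0 (ltnW b1).
Qed.

Definition input_cells (n : nat) (Ps : seq (seq nat)) : seq nat :=
  [:: n, size Ps & [seq code (2 ^ block_width n) q | q <- Ps]].

Theorem theorem6p2 :
  exists (p : program) (c C : nat),
  forall (Pi : seq (seq nat)) (k n w : nat),
    Pi != [::] ->
    uniq Pi ->
    (forall pat : seq nat, pat \in Pi -> is_permutation (size pat) pat) ->
    \max_(pat <- Pi) size pat = k ->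
    0 < k ->
    0 < n ->
    c * (n * block_width n) <= w ->
    exists t : nat,
      [/\ t <= C * (n`! * k),
          halted p (run p w t (input Pi n)),
          (forall s : nat, s <= t ->
             space (run p w s (input Pi n)) <= C * (n ^ k.+1 * k)) &
          (forall m : nat,
             output (run p w t (input Pi n)) m =
               N.of_nat (num_perms_with_hits Pi n m))].
Proof.
(* The 8 is the constant of [w_large]. The time is at most (480 + 405 + 9 + 20) n! k, the terms of
   [program_ok] in order, and 1000 also covers the space. *)
exists prog, 8, 1000 => Pi k n w _ uPi permPi maxk k0 n0 ltw.
pose Ps := [seq q <- Pi | size q <= n].
have uPs : uniq Ps by exact: filter_uniq.
have permPs q : q \in Ps -> is_permutation (size q) q /\ size q <= n.
  by rewrite mem_filter => /andP[szq /permPi].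
set K := \max_(q <- Ps) size q.
have leK : K <= k.
  apply/bigmax_leqP_seq => q; rewrite mem_filter => /andP[_ qP] _.
  by rewrite -maxk; apply: (leq_bigmax_seq (F := size)).
have w0 : 0 < w by apply: leq_trans ltw; rewrite !muln_gt0 n0.
set B := 2 ^ block_width n.
pose M := nth 0 (input_cells n Ps).
have memE : mem (input Pi n) = map N.of_nat (input_cells n Ps).
  rewrite /input /input_cells /= -map_comp; congr [:: _, _ & _].
  by apply: eq_map => q; rewrite /= encode_code.
have ltM a : M a < 2 ^ w.
  have: all (fun x => x < 2 ^ w) (input_cells n Ps).
    rewrite /input_cells /= (small_lt_w Ps n0 ltw) //=.
    rewrite (leq_ltn_trans _ (nmem_lt_w n0 ltw permPs uPs)) /=; last by lia.
    apply/allP => _ /mapP[q qP ->].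
    apply: (@code_lt_w _ _ Ps n0 ltw _ n).
    - exact: digits_lt (pattern_digits n0 ltw permPs qP).
    - by have [] := permPs q qP.
    - by lia.
  move=> /allP H; case: (ltnP a (size (input_cells n Ps))) => lta.
    by apply: H; exact: mem_nth.
  by rewrite /M nth_default // expn_gt0.
have Hout x : (size Ps).+2 <= x -> M x = 0.
  by move=> lex; rewrite /M nth_default //= size_map.
have HM i : i < size Ps -> M i.+2 = code B (nth [::] Ps i).
  by move=> lti; rewrite /M /= (nth_map [::]).
have [t [[pc' [R' M' T']] [let_ Hreach /= [Epc Ebase Elen Ecount]]]] :=
  program_ok n0 ltw permPs uPs (erefl : M 0 = n) (erefl : M 1 = size Ps) HM Hout.
have Hrep : rep w 23 ((size Ps).+2 + (node_count K n).+1) 3 (keys n Ps) (input Pi n)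
    (0, MState (fun _ => 0) M (fun _ _ => None)).
  split=> //.
  - split=> // [r|r]; first by rewrite /reg nth_nil.
    by rewrite expn_gt0.
  - split=> // [a|]; first by rewrite /cell memE nth_map_of_nat.
    by rewrite memE size_map /= size_map leq_addr.
  - have tab0 h : tab (input Pi n) h = [::] by rewrite /tab nth_nil.
    by split=> // [h k'|h]; rewrite tab0.
have [[Epc' [Hreg _ _] [Hcell _ _] _] Hspace] := reach_run w0 Hrep Hreach.
have F1 : node_count K n < 3 * n`! by exact: node_count_fact.
have F2 : node_count K n <= 2 * (n ^ k * k).
  apply: leq_trans (node_count_exp K n0) _; rewrite mulnCA mulnC leq_mul //; last by lia.
  by rewrite leq_pexp2l.
have szPs : size Ps <= node_count K n by exact: (size_Ps permPs uPs).
exists t; split.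
- apply: leq_trans let_ _; rewrite -/K.
  have := visit_count_leq K n; have := leq_fact n; have := fact_gt0 n.
  have : K.+1 * (3 * n`!) <= 2 * k * (3 * n`!) by rewrite leq_mul2r; lia.
  by nia.
- by rewrite /halted /current_instr Epc' Epc.
- move=> s les; apply: leq_trans (Hspace s les) _.
  (* The term (n + 1) [node_count K n] of table 2 dominates the space and supplies the factor n
     beyond n^k k. *)
  have S0 : size (keys n Ps 0) = size Ps by rewrite size_map.
  have S1 : size (keys n Ps 1) = node_count K n by rewrite size_map size_nodes size_iota.
  have S2 : size (keys n Ps 2) = n.+1 * node_count K n.
    by rewrite size_allpairs size_nodes !size_iota.
  have -> : \sum_(h < 3) (size (keys n Ps h)).+1 = (size (keys n Ps 0)).+1 +
      ((size (keys n Ps 1)).+1 + ((size (keys n Ps 2)).+1 + 0)).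
    by rewrite !big_ord_recl big_ord0.
  rewrite S0 S1 S2 -/K.
  have : 0 < n ^ k * k by rewrite muln_gt0 expn_gt0 n0.
  have -> : n ^ k.+1 * k = n * (n ^ k * k) by rewrite expnS mulnA.
  by nia.
- move=> m; rewrite /output !Hreg Ebase Elen !Nat2N.id Hcell Ecount.
  have szt tau : tau \in permutations (iota 1 n) -> size tau = n.
    by rewrite mem_permutations => /perm_size; rewrite size_iota.
  have Enum : num_perms_with_hits Pi n m =
      count (fun tau => hits Ps tau [::] == m) (leaves n (iota 1 n) [::]).
    have := perm_leaves (iota_uniq 1 n); rewrite size_iota => /permP ->.
    by apply: eq_in_count => tau /szt sz; rewrite (@num_hits_filter _ n) ?sz.
  rewrite -Enum; case: ltnP => // lem.
  (* Beyond the array the output is 0, rightly so: every number of hits is below 3 B^n < B^(n+2),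
     the length of the array. *)
  rewrite (_ : num_perms_with_hits Pi n m = 0) //; apply/eqP.
  rewrite -leqn0 leqNgt -has_count; apply/hasPn => tau /szt sz.
  rewrite (@num_hits_filter _ n) ?sz // neq_ltn; apply/orP; left.
  apply: leq_trans lem.
  have := hits_leq tau [::] (@size_Ps_K Ps); rewrite subn0 sz => leh.
  apply: leq_ltn_trans leh _; apply: ltn_trans (node_count_lt n Ps) _.
  exact: ltn_exp_add2 (B_gt1 n).
Qed.
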